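(* Let $R>0$, $\Omega=(-R,R)$, and let $f$ be an even function on $(-R,R)$ with $\int_0^R |f(s)|(R-s)\,ds<\infty$. Suppose there is $r_0\in(0,R)$ such that $f(r)\ge 0$ for a.e. $r\in(0,r_0)$, $f^+$ is not a.e. zero on $(0,r_0)$, and $f(r)\le 0$ for a.e. $r\in(r_0,R)$. (A) Assume the balance condition $$\int_0^{r_0} f^+(s)(R-r_0)\,ds>\int_{r_0}^R f^-(s)(R-s)\,ds$$ and the decay condition $$\int_r^R\Big(\int_{r_0}^t f^-(s)\,ds\Big)dt<(R-r)\int_0^{r_0}f^+(s)\,ds\quad\text{for every } r\in(r_0,R).$$ Then every even very weak supersolution $u$ of $-u''\ge f$ in $(-R,R)$, $u(\pm R)=0$, satisfies $u>0$ in $(-R,R)$. If moreover $u\in C^1([-R,R])$, then $u'(R)\le 0$ and $u'(-R)\ge 0$. Furthermore, if the balance condition holds and $u$ is the very weak solution of $-u''=f$ in $(-R,R)$, $u(\pm R)=0$, then $u>0$ in $(-R,R)$ if and only if the decay condition holds. (B) Assume the balance and decay conditions and in addition $\int_{r_0}^R f^-(s)\,ds<\infty$. Let $u$ be the unique very weak solution of $-u''=f$ in $(-R,R)$, $u(\pm R)=0$. Then $u\in C^1([-R,R])$, and $u'(\pm R)=0$ (i.e. $u$ is flat) if and only if $\int_0^{r_0}f^+(s)\,ds=\int_{r_0}^R f^-(s)\,ds$, i.e. $\int_0^R f(s)\,ds=0$.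
   Context: $f^+=\max(f,0)$, $f^-=-\min(f,0)$, so $f=f^+-f^-$. $\delta(x)=\operatorname{dist}(x,\partial\Omega)$ and $L^1(\Omega:\delta)=\{g\in L^1_{loc}(\Omega):\int_\Omega|g|\delta<\infty\}$. A very weak supersolution of $-u''\ge f$ in $\Omega$, $u=0$ on $\partial\Omega$ (with $f\in L^1(\Omega:\delta)$) is a function $u\in L^1(\Omega)$ such that $-\int_\Omega u\psi''\ge\int_\Omega f\psi$ for every $\psi\in W^{2,\infty}(\Omega)\cap W^{1,\infty}_0(\Omega)$ with $\psi\ge0$; a very weak solution is defined in the same way with equality for all $\psi\in W^{2,\infty}(\Omega)\cap W^{1,\infty}_0(\Omega)$. Such a solution exists and is unique, and for even data it is even. *)

(* Defs.v *)
From HB Require Import structures.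
From mathcomp Require Import all_boot all_order all_algebra.
From mathcomp Require Import all_classical all_reals all_analysis.
Set Implicit Arguments. Unset Strict Implicit. Unset Printing Implicit Defensive.
Import Order.TTheory GRing.Theory Num.Theory.
Import numFieldNormedType.Exports.
Local Open Scope classical_set_scope.
Local Open Scope ring_scope.

Section Defs.
Context {R : realType}.
Notation mu := (@lebesgue_measure R).

Definition fpos (f : R -> R) (x : R) : R := Num.max (f x) 0.
Definition fneg (f : R -> R) (x : R) : R := - Num.min (f x) 0.

(** psi belongs to W^{2,oo}(Omega) \cap W^{1,oo}_0(Omega), Omega = (-rad,rad),
    with weak first derivative dpsi and weak second derivative d2psi,
    written out on the absolutely continuous representative:
    d2psi is measurable and essentially bounded, dpsi is an antiderivative
    of d2psi, psi an antiderivative of dpsi, and psi vanishes at +-rad. *)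
Definition W2inf_W1inf0 (rad : R) (psi dpsi d2psi : R -> R) : Prop :=
  [/\ measurable_fun (`[-rad, rad]%classic)%R d2psi,
      (exists M : R, {ae mu, forall x, x \in `]-rad, rad[ -> `|d2psi x| <= M}),
      (forall x, x \in `[-rad, rad] ->
         dpsi x = dpsi (- rad) + Rintegral mu (`[-rad, x]%classic)%R d2psi),
      (forall x, x \in `[-rad, rad] ->
         psi x = psi (- rad) + Rintegral mu (`[-rad, x]%classic)%R dpsi)
      & psi (- rad) = 0 /\ psi rad = 0].

Definition vw_supersolution (rad : R) (f u : R -> R) : Prop :=
  mu.-integrable (`]-rad, rad[%classic)%R (EFin \o u) /\
  forall psi dpsi d2psi, W2inf_W1inf0 rad psi dpsi d2psi ->
    (forall x, x \in `]-rad, rad[ -> 0 <= psi x) ->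
    (\int[mu]_(x in (`]-rad, rad[%classic)%R) (f x * psi x)%R%:E
      <= - (\int[mu]_(x in (`]-rad, rad[%classic)%R) (u x * d2psi x)%R%:E))%E.

Definition vw_solution (rad : R) (f u : R -> R) : Prop :=
  mu.-integrable (`]-rad, rad[%classic)%R (EFin \o u) /\
  forall psi dpsi d2psi, W2inf_W1inf0 rad psi dpsi d2psi ->
    (- (\int[mu]_(x in (`]-rad, rad[%classic)%R) (u x * d2psi x)%R%:E)
      = \int[mu]_(x in (`]-rad, rad[%classic)%R) (f x * psi x)%R%:E)%E.

(** "u > 0 in (-rad,rad)": the (unique) continuous representative of the
    L^1 class u on (-rad,rad) exists and is positive everywhere. *)
Definition pos_in (rad : R) (u : R -> R) : Prop :=
  exists v : R -> R,
    [/\ {within (`]-rad, rad[%classic)%R, continuous v},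
        {ae mu, forall x, x \in `]-rad, rad[ -> v x = u x} &
        forall x, x \in `]-rad, rad[ -> 0 < v x].

(** v, with derivative dv, is a C^1([-rad,rad]) representative of u:
    v = u a.e. in (-rad,rad), v is continuous on [-rad,rad], differentiable in
    (-rad,rad) with derivative dv, and dv is continuous on [-rad,rad]
    (so dv(+-rad) are the one-sided derivatives u'(+-rad)). *)
Definition C1_rep (rad : R) (u v dv : R -> R) : Prop :=
  [/\ {ae mu, forall x, x \in `]-rad, rad[ -> v x = u x},
      {within (`[-rad, rad]%classic)%R, continuous v},
      {within (`[-rad, rad]%classic)%R, continuous dv} &
      forall x, x \in `]-rad, rad[ -> is_derive x (1 : R) v (dv x)].

Definition balance (rad r0 : R) (f : R -> R) : Prop :=
  (\int[mu]_(s in (`]r0, rad[%classic)%R) (fneg f s * (rad - s))%R%:E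
    < \int[mu]_(s in (`]0, r0[%classic)%R) (fpos f s * (rad - r0))%R%:E)%E.

Definition decay (rad r0 : R) (f : R -> R) : Prop :=
  forall r, r \in `]r0, rad[ ->
    (\int[mu]_(t in (`]r, rad[%classic)%R)
        (\int[mu]_(s in (`]r0, t[%classic)%R) (fneg f s)%:E)
      < (rad - r)%R%:E * \int[mu]_(s in (`]0, r0[%classic)%R) (fpos f s)%:E)%E.

End Defs.

(* Main.v *)
Require Import Defs.
From HB Require Import structures.
From mathcomp Require Import all_boot all_order all_algebra.
From mathcomp Require Import all_classical all_reals all_analysis.
From mathcomp Require Import measurable_realfun lra ring.
Import Order.TTheory GRing.Theory Num.Theory.
Import numFieldNormedType.Exports.
Local Open Scope classical_set_scope.
Local Open Scope ring_scope.

(** Let F(t) = \int_0^t f, which is odd, and w(x) = \int_x^R F, the even weak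
    solution of -w'' = f (two applications of Fubini's theorem).  For a
    supersolution u, the function g = u - w satisfies \int g psi'' <= 0 for all
    nonnegative test functions psi.  Taking psi'' = - 1_E gives g >= 0 a.e.; taking
    for psi'' averages of Dirac masses at three points gives the concavity
    inequality for g at all Lebesgue points.  A nonnegative concave function on a
    dense set extends continuously, so u has the representative w + g >= w; for a
    solution both signs apply and u = w a.e.
    With P and N(t) the masses of f^+ on (0,r0) and of f^- on (r0,t) one has
    F = P - N on (r0,R), so the decay condition says precisely w > 0 on (r0,R).
    As F is nonincreasing there, it then forces F >= 0 on (0,R): w is nonincreasing
    and positive.  Since g is even and concave, u is nonincreasing near R, which
    gives the sign of u'(R); in the flat case w'(R) = - F(R) = N(R) - P. *)

Set Implicit Arguments.
Unset Strict Implicit.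

(** * Reflection and Fubini on a triangle *)

Section integrals.
Context {R : realType}.
Notation mu := (@lebesgue_measure R).

(** Two obstacles shape the proof. First, [f] is integrable only against the distance to the
    boundary, so its integrals cannot start at an endpoint: [F] starts at 0, and the first exchange
    of integrals is done on each half interval, where the section of the triangle over [x] has
    length [R - x], exactly the available weight. This makes [F] integrable even when [f] is not,
    and the second exchange then concerns two integrable functions. The constant [psi'(-R)] left by
    it is multiplied by the integral of the odd function [F], which is 0. Second, positivity is
    claimed at every point for a continuous representative, whereas [u] is only an L^1 class, so
    [g >= 0] a.e. is not enough. Concavity together with [g >= 0] bounds the slopes of [g] away from
    the endpoints, and this is what lets [g] extend continuously from the Lebesgue points. Test
    functions have bounded second derivative, so Dirac masses are replaced by normalized indicators
    of [[a, a + e]], and [e] tends to 0 from the right. *)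

Lemma integral_oppr (D : set R) (f : R -> \bar R) :
  measurable D -> measurable_fun D f ->
  (\int[mu]_(x in (-%R @^-1` D)) f (- x)%R = \int[mu]_(x in D) f x)%E.
Proof.
move=> mD mf.
have mopp : measurable_fun [set: measurableTypeR R] (-%R : _ -> measurableTypeR R).
  exact: oppr_measurable.
(* Nonnegative integrands first: the pushforward of [mu] under reflection is [mu]. Positive and
   negative parts are then treated separately. *)
have ge0 (g : R -> \bar R) : measurable_fun D g -> (forall x, 0 <= g x)%E ->
    (\int[mu]_(x in (-%R @^-1` D)) g (- x)%R = \int[mu]_(x in D) g x)%E.
  move=> mg g0.
  transitivity (\int[pushforward mu (-%R : _ -> measurableTypeR R)]_(y in D) g y)%E.
    by rewrite ge0_integral_pushforward.
  by apply: eq_measure_integral => //= A mA AS; exact: lebesgue_measureN.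
rewrite -[X in integral _ _ X]/(f \o -%R) integralE [RHS]integralE.
rewrite funepos_comp funeneg_comp; congr (_ - _)%E.
- by apply: (ge0 (f^\+)%E) => //; exact: measurable_funepos.
- by apply: (ge0 (f^\-)%E) => //; exact: measurable_funeneg.
Qed.

Lemma opp_preimage_oo (a b : R) : -%R @^-1` `]a, b[%classic = `]- b, - a[%classic.
Proof. by apply/seteqP; split=> x /=; rewrite !in_itv/= ltrNl ltrNr andbC. Qed.

Lemma integral_oppr_oo (a b : R) (f : R -> \bar R) :
  measurable_fun `]a, b[ f ->
  (\int[mu]_(x in `](- b)%R, (- a)%R[) f (- x)%R = \int[mu]_(x in `]a, b[) f x)%E.
Proof. by move=> mf; rewrite -[RHS]integral_oppr// opp_preimage_oo. Qed.

Lemma Rintegral_oppr_oo (a b : R) (f : R -> R) :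
  measurable_fun `]a, b[ f ->
  \int[mu]_(x in `]- b, - a[) f (- x)%R = \int[mu]_(x in `]a, b[) f x.
Proof.
move=> mf; rewrite /Rintegral -[in RHS]integral_oppr_oo//.
exact/measurable_EFinP.
Qed.

Lemma measurable_fun_oppr_oo d (T : measurableType d) (a b : R) (f : R -> T) :
  measurable_fun `]a, b[ f -> measurable_fun `]- b, - a[ (fun x => f (- x)).
Proof.
move=> mf; apply: (@measurable_comp _ _ _ _ _ _ `]a, b[) => //.
  by move=> _ [x /= + <-]; rewrite !in_itv/= ltrNl ltrNr andbC.
Qed.

Lemma integrable_oppr_oo (a b : R) (f : R -> \bar R) :
  mu.-integrable `]a, b[ f ->
  mu.-integrable `]- b, - a[ (fun x => f (- x)).
Proof.
move=> /integrableP[mf fi]; apply/integrableP; split.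
  exact: measurable_fun_oppr_oo.
by rewrite (@integral_oppr_oo _ _ (abse \o f))//; exact: measurableT_comp.
Qed.

Lemma integrable_cc_oo (a b : R) (f : R -> R) :
  mu.-integrable `]a, b[ (EFin \o f) <-> mu.-integrable `[a, b] (EFin \o f).
Proof.
split; last by apply: integrableS => //; exact: subset_itv_oo_cc.
move=> /integrableP[mf fi]; apply/integrableP; split.
  exact: emeasurable_fun_itv_cc mf.
by rewrite integral_itv_bndoo//; exact: measurableT_comp.
Qed.

Lemma Rintegral_cc_oo (a b : R) (f : R -> R) : measurable_fun `]a, b[ f ->
  \int[mu]_(x in `[a, b]) f x = \int[mu]_(x in `]a, b[) f x.
Proof.
by move=> mf; rewrite /Rintegral integral_itv_bndoo//; exact/measurable_EFinP.
Qed.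

Lemma integrable_measurable_fun (D : set R) (f : R -> R) :
  mu.-integrable D (EFin \o f) -> measurable_fun D f.
Proof. by move=> /measurable_int/measurable_EFinP. Qed.

Lemma integrable_sub_oo (a b c d : R) (f : R -> \bar R) : c <= a -> b <= d ->
  mu.-integrable `]c, d[ f -> mu.-integrable `]a, b[ f.
Proof.
by move=> ca bd; apply: integrableS => //; apply: subset_itv; rewrite bnd_simp.
Qed.

Lemma integrableB_fin (D : set R) (f g : R -> R) : measurable D ->
  mu.-integrable D (EFin \o f) -> mu.-integrable D (EFin \o g) ->
  mu.-integrable D (EFin \o (fun x => f x - g x)).
Proof. by move=> mD fi gi; apply: eq_integrable (integrableB _ fi gi). Qed.

Lemma integrableZ_fin (D : set R) (c : R) (f : R -> R) : measurable D ->
  mu.-integrable D (EFin \o f) -> mu.-integrable D (EFin \o (fun x => c * f x)).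
Proof. by move=> mD fi; apply: eq_integrable (integrableZl _ c fi). Qed.

Lemma measurable_sub_oo (a b c d : R) (f : R -> R) : c <= a -> b <= d ->
  measurable_fun `]c, d[ f -> measurable_fun `]a, b[ f.
Proof.
by move=> ca bd; apply: measurable_funS => //; apply: subset_itv; rewrite bnd_simp.
Qed.

Lemma Rintegral_chasles (a b c : R) (f : R -> R) : a <= b -> b <= c ->
  mu.-integrable `]a, c[ (EFin \o f) ->
  \int[mu]_(x in `]a, c[) f x =
  \int[mu]_(x in `]a, b[) f x + \int[mu]_(x in `]b, c[) f x.
Proof.
move=> ab bc fi.
have fi1 : mu.-integrable `]a, b[ (EFin \o f).
  by apply: integrableS fi => //; apply: subset_itvl; rewrite bnd_simp.
have fi2 : mu.-integrable `]b, c[ (EFin \o f).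
  by apply: integrableS fi => //; apply: subset_itvr; rewrite bnd_simp.
rewrite (Rintegral_itv_bndo_bndc fi2).
have := @Rintegral_itvB _ f (BLeft a) (BRight c) b.
rewrite (Rintegral_cc_oo (integrable_measurable_fun fi)).
rewrite (Rintegral_cc_oo (integrable_measurable_fun fi1)).
by move=> <-; rewrite ?bnd_simp//; [lra|exact/integrable_cc_oo].
Qed.

Lemma aeS (P Q : R -> Prop) : (forall x, P x -> Q x) ->
  {ae mu, forall x, P x} -> {ae mu, forall x, Q x}.
Proof.
by move=> PQ; apply: filterS => //; exact: (ae_filter_ringOfSetsType mu).
Qed.

Lemma aeI (P Q : R -> Prop) :
  {ae mu, forall x, P x} -> {ae mu, forall x, Q x} ->
  {ae mu, forall x, P x /\ Q x}.
Proof. by apply: filterI; exact: (ae_filter_ringOfSetsType mu). Qed.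

Lemma Rintegral_ae_eq (D : set R) (f g : R -> R) : measurable D ->
  measurable_fun D f -> measurable_fun D g ->
  {ae mu, forall x, D x -> f x = g x} ->
  \int[mu]_(x in D) f x = \int[mu]_(x in D) g x.
Proof.
move=> mD mf mg fg; congr fine; apply: ae_eq_integral => //.
- exact/measurable_EFinP.
- exact/measurable_EFinP.
- by apply: aeS fg => x + Dx => /(_ Dx)/= ->.
Qed.

(** Integrand of both iterated integrals below, cut off to the triangle [l < z.1 < z.2 < r] but
    defined on the whole plane, so that Fubini's theorem on the product space applies. *)
Let K l r (a b : R -> R) (z : R * R) : R :=
  (a \_ `]l, r[) z.1 * (b \_ `]l, r[) z.2 * (z.1 < z.2)%R%:R.

Let mK (l r : R) (a b : R -> R) : measurable_fun `]l, r[ a -> measurable_fun `]l, r[ b ->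
  measurable_fun setT (K l r a b).
Proof.
move=> ma mb; apply: measurable_funM; first apply: measurable_funM.
- apply: (measurableT_comp (f := a \_ `]l, r[)); last exact: measurable_fst.
  exact/(measurable_restrictT _ _).1.
- apply: (measurableT_comp (f := b \_ `]l, r[)); last exact: measurable_snd.
  exact/(measurable_restrictT _ _).1.
rewrite (_ : (fun x => _) = (fun z : R * R => if z.1 < z.2 then 1 else 0)); last first.
  by apply/funext => z; case: ifP.
apply: measurable_fun_ifT => //; apply: measurable_fun_ltr => //.
Qed.

Let K1 (l r : R) (a b : R -> R) :
  (fun x => \int[mu]_t (K l r a b (x, t))%:E)%E =
  (fun x => \int[mu]_(t in `]x, r[) (a x * b t)%:E)%E \_ `]l, r[.
Proof.
apply/funext => x; rewrite [RHS]patchE; case: ifPn => [|]; last first.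
  move=> xlr; apply: integral0_eq => t _.
  by rewrite /K patchE (negbTE xlr)/= !mul0r.
rewrite inE/= in_itv/= => /andP[lx xr].
rewrite [RHS]integral_mkcond; apply: eq_integral => t _.
rewrite /K patchE mem_set/=; last by rewrite in_itv/= lx.
rewrite [in RHS]patchE; case: ifPn.
  rewrite inE/= in_itv/= => /andP[xt tr].
  by rewrite patchE mem_set/= ?in_itv/= ?tr ?(lt_trans lx xt)// xt mulr1.
move=> tni; rewrite patchE; case: ifPn => /= [|_]; last by rewrite mulr0 mul0r.
rewrite inE/= in_itv/= => /andP[lt tr].
case: ltP => [xt|]; last by rewrite mulr0.
by move: tni; rewrite notin_setE/= in_itv/= xt tr.
Qed.

Let K2 (l r : R) (a b : R -> R) :
  (fun t => \int[mu]_x (K l r a b (x, t))%:E)%E =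
  (fun t => \int[mu]_(x in `]l, t[) (a x * b t)%:E)%E \_ `]l, r[.
Proof.
apply/funext => t; rewrite [RHS]patchE; case: ifPn => [|]; last first.
  move=> xlr; apply: integral0_eq => x _.
  by rewrite /K [X in _ * X * _]patchE (negbTE xlr)/= mulr0 mul0r.
rewrite inE/= in_itv/= => /andP[lt tr].
rewrite [RHS]integral_mkcond; apply: eq_integral => x _.
rewrite /K [X in _ * X * _]patchE mem_set/=; last by rewrite in_itv/= lt.
rewrite [in RHS]patchE; case: ifPn.
  rewrite inE/= in_itv/= => /andP[lx xt].
  by rewrite patchE mem_set/= ?in_itv/= ?lx ?(lt_trans xt tr)// xt mulr1.
move=> tni; rewrite patchE; case: ifPn => /= [|_]; last by rewrite !mul0r.
rewrite inE/= in_itv/= => /andP[lx xr].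
case: ltP => [xt|]; last by rewrite mulr0.
by move: tni; rewrite notin_setE/= in_itv/= lx xt.
Qed.

Let triangle (l r : R) (a b : R -> R) :
  measurable_fun `]l, r[ a -> measurable_fun `]l, r[ b ->
  (forall x, l < x -> x < r -> mu.-integrable `]x, r[ (EFin \o b)) ->
  (forall t, l < t -> t < r -> mu.-integrable `]l, t[ (EFin \o a)) ->
  (mu \x mu)%E.-integrable setT (EFin \o K l r a b) ->
  [/\ mu.-integrable `]l, r[ (fun x => (a x * \int[mu]_(t in `]x, r[) b t)%:E),
      mu.-integrable `]l, r[ (fun t => (b t * \int[mu]_(x in `]l, t[) a x)%:E) &
      \int[mu]_(x in `]l, r[) (a x * \int[mu]_(t in `]x, r[) b t) =
      \int[mu]_(t in `]l, r[) (b t * \int[mu]_(x in `]l, t[) a x)].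
Proof.
move=> ma mb ib ia iK.
have mKE : measurable_fun setT (EFin \o K l r a b) by apply/measurable_EFinP; exact: mK.
have e1 x : x \in `]l, r[%classic ->
    (\int[mu]_(t in `]x, r[) (a x * b t)%:E)%E = (a x * \int[mu]_(t in `]x, r[) b t)%:E.
  rewrite inE/= in_itv/= => /andP[lx xr].
  rewrite -RintegralZl//; last exact: ib.
  rewrite fineK//; apply: integrable_fin_num => //.
  exact: (integrableZl _ (a x) (ib _ lx xr)).
have e2 t : t \in `]l, r[%classic ->
    (\int[mu]_(x in `]l, t[) (a x * b t)%:E)%E = (b t * \int[mu]_(x in `]l, t[) a x)%:E.
  rewrite inE/= in_itv/= => /andP[lt tr].
  under eq_integral do rewrite mulrC.
  rewrite -RintegralZl//; last exact: ia.
  rewrite fineK//; apply: integrable_fin_num => //.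
  exact: (integrableZl _ (b t) (ia _ lt tr)).
split.
- apply: (@eq_integrable _ _ _ mu _ _ (fun x => \int[mu]_(t in `]x, r[) (a x * b t)%:E)%E) => //.
  apply/integrable_mkcond => //; rewrite -K1.
  exact: (integrable_fubini_F iK).
- apply: (@eq_integrable _ _ _ mu _ _ (fun t => \int[mu]_(x in `]l, t[) (a x * b t)%:E)%E) => //.
  apply/integrable_mkcond => //; rewrite -K2.
  (* The inner integral is dominated by that of [|K|], whose iterated integral in this order is
     finite. *)
  apply/integrableP; split; first exact: (measurable_fubini_G iK).
  apply: le_lt_trans ((integrable21ltyP mu mu mKE).1 iK).
  apply: ge0_le_integral => //.
  - by apply: measurableT_comp => //; exact: (measurable_fubini_G iK).
  - have := @measurable_fun_fubini_tonelli_G _ _ _ _ R mu (abse \o (EFin \o K l r a b)).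
    apply; last by move=> x; exact: abse_ge0.
    by apply: (measurableT_comp _ mKE); exact: abse_measurable.
  - move=> t _; apply: le_abse_integral => //.
    exact: (measurableT_comp (f := EFin \o K l r a b)).
congr fine; have := Fubini iK.
rewrite /= K1 K2 -!integral_mkcond => e.
transitivity (\int[mu]_(x in `]l, r[) \int[mu]_(t in `]x, r[) (a x * b t)%:E)%E.
  by apply: eq_integral => x xlr; rewrite e1.
by rewrite e; apply: eq_integral => t tlr; rewrite e2.
Qed.

(** On []l, t[] the weight [r - x] stays above [r - t > 0], so it can be divided out. *)
Lemma integrable_weight (l r t : R) (a : R -> R) : t < r ->
  measurable_fun `]l, r[ a ->
  (\int[mu]_(x in `]l, r[) (`|a x| * (r - x))%:E < +oo)%E ->
  mu.-integrable `]l, t[ (EFin \o a).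
Proof.
move=> tr ma H.
have H2 : mu.-integrable `]l, r[ (fun x => (`|a x| * (r - x))%:E).
  apply/integrableP; split.
    apply/measurable_EFinP; apply: measurable_funM; first exact: measurableT_comp.
    by apply: measurable_funB.
  move: H; congr (_ < _)%E; apply: eq_integral => x.
  rewrite inE/= in_itv/= => /andP[_ xr].
  by rewrite /= normrM normr_id [`|r - x|]ger0_norm// subr_ge0 ltW.
have sub : `]l, t[ `<=` `]l, r[ by apply: subset_itvl; rewrite bnd_simp ltW.
have H3 : mu.-integrable `]l, t[ (fun x => ((r - t)^-1)%:E * (`|a x| * (r - x))%:E)%E.
  by apply: integrableZl => //; exact: integrableS H2.
apply: le_integrable H3 => //.
  by apply/measurable_EFinP; exact: measurable_funS ma.
move=> x /=; rewrite in_itv/= => /andP[lx xt].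
rewrite lee_fin [leRHS]ger0_norm; last first.
  by rewrite !mulr_ge0 ?invr_ge0 ?subr_ge0//; lra.
rewrite mulrCA ler_peMr//.
by rewrite ler_pdivlMl ?subr_gt0//; lra.
Qed.

(** The section of the triangle over [x] has length [r - x]; hence for [b = 1] the integral of [|K|]
    is the weighted integral of [|a|], and a bounded [b] costs a factor [C]. This is the form
    applied to [f]. *)
Lemma integral_triangle_bounded (l r C : R) (a b : R -> R) :
  measurable_fun `]l, r[ a -> measurable_fun `]l, r[ b ->
  (forall t, t \in `]l, r[ -> `|b t| <= C) ->
  (\int[mu]_(x in `]l, r[) (`|a x| * (r - x))%:E < +oo)%E ->
  [/\ mu.-integrable `]l, r[ (fun x => (a x * \int[mu]_(t in `]x, r[) b t)%:E),
      mu.-integrable `]l, r[ (fun t => (b t * \int[mu]_(x in `]l, t[) a x)%:E) &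
      \int[mu]_(x in `]l, r[) (a x * \int[mu]_(t in `]x, r[) b t) =
      \int[mu]_(t in `]l, r[) (b t * \int[mu]_(x in `]l, t[) a x)].
Proof.
move=> ma mb bC H; apply: triangle => //.
- move=> x lx xr; apply: measurable_bounded_integrable => //.
  + by rewrite /= lebesgue_measure_itv/= lte_fin xr -EFinB ltry.
  + by apply: measurable_funS mb => //; apply: subset_itvr; rewrite bnd_simp ltW.
  + exists C; split; first exact: num_real.
    move=> M CM t /=; rewrite in_itv/= => /andP[xt tr].
    by apply: le_trans (ltW CM); apply: bC; rewrite in_itv/= tr (lt_trans lx).
- by move=> t lt tr; exact: integrable_weight H.
have iK : (mu \x mu)%E.-integrable setT (EFin \o K l r a (cst 1)).
  have mKE : measurable_fun setT (EFin \o K l r a (cst 1)).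
    by apply/measurable_EFinP; exact: mK.
  apply/(integrable12ltyP mu mu mKE) => /=.
  rewrite (_ : (fun x => _) =
      (fun x => \int[mu]_t (K l r (fun x => `|a x|) (cst 1) (x, t))%:E)%E).
    rewrite K1 -integral_mkcond; move: H; congr (_ < _)%E.
    apply: eq_integral => x; rewrite inE/= in_itv/= => /andP[lx xr].
    by rewrite integral_cst//= /= lebesgue_measure_itv/= lte_fin xr -EFinB -EFinM mulr1.
  apply/funext => x; apply: eq_integral => t _ /=.
  rewrite /K !normrM !patchE/=; congr (_ * _ * _)%:E.
  - by case: ifP => //; rewrite normr0.
  - by case: ifP => //; rewrite ?normr0 ?normr1.
  - by rewrite ger0_norm// ler0n.
have iK' := integrableZl measurableT C iK.
apply: le_integrable iK' => //.
- by apply/measurable_EFinP; exact: mK.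
- move=> z _ /=; rewrite lee_fin /K !normrM [leRHS]mulrCA !mulrA.
  rewrite ler_wpM2r// -mulrA ler_wpM2l//.
  rewrite !patchE; case: ifPn => [|_]; last by rewrite normr0 mul0r.
  by move=> /set_mem/bC h; rewrite normr1 mul1r (le_trans h)// ler_norm.
Qed.

(** Here [|K|] is dominated by the tensor product of [|a|] and [|b|] on the square, whose integral
    factors. This is the form applied to [primitive f] and [d2psi]. *)
Lemma integral_triangle_integrable (l r : R) (a b : R -> R) :
  mu.-integrable `]l, r[ (EFin \o a) -> mu.-integrable `]l, r[ (EFin \o b) ->
  [/\ mu.-integrable `]l, r[ (fun x => (a x * \int[mu]_(t in `]x, r[) b t)%:E),
      mu.-integrable `]l, r[ (fun t => (b t * \int[mu]_(x in `]l, t[) a x)%:E) &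
      \int[mu]_(x in `]l, r[) (a x * \int[mu]_(t in `]x, r[) b t) =
      \int[mu]_(t in `]l, r[) (b t * \int[mu]_(x in `]l, t[) a x)].
Proof.
move=> ia ib.
have ma := integrable_measurable_fun ia; have mb := integrable_measurable_fun ib.
apply: triangle => //.
- by move=> x lx xr; apply: integrableS ib => //; apply: subset_itvr; rewrite bnd_simp ltW.
- by move=> t lt tr; apply: integrableS ia => //; apply: subset_itvl; rewrite bnd_simp ltW.
pose P (z : R * R) := (a \_ `]l, r[) z.1 * (b \_ `]l, r[) z.2.
have mP : measurable_fun setT P.
  apply: measurable_funM.
  - apply: (measurableT_comp (f := a \_ `]l, r[)); last exact: measurable_fst.
    exact/(measurable_restrictT _ _).1.
  - apply: (measurableT_comp (f := b \_ `]l, r[)); last exact: measurable_snd.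
    exact/(measurable_restrictT _ _).1.
have mPE : measurable_fun setT (EFin \o P) by exact/measurable_EFinP.
have iP : (mu \x mu)%E.-integrable setT (EFin \o P).
  apply/(integrable12ltyP mu mu mPE) => /=.
  have ia' : mu.-integrable setT (EFin \o (a \_ `]l, r[)).
    rewrite -restrict_EFin.
    by case: (integrable_mkcond (mu := mu) (EFin \o a) (measurable_itv `]l, r[)) => + _; apply.
  have ib' : mu.-integrable setT (EFin \o (b \_ `]l, r[)).
    rewrite -restrict_EFin.
    by case: (integrable_mkcond (mu := mu) (EFin \o b) (measurable_itv `]l, r[)) => + _; apply.
  have [ma' fa] := integrableP _ _ _ ia'; have [mb' fb] := integrableP _ _ _ ib'.
  have -> : (\int[mu]_x \int[mu]_y `|P (x, y)|%:E)%E =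
      (\int[mu]_x (`|((a \_ `]l, r[) x)%:E| * \int[mu]_t `|((b \_ `]l, r[) t)%:E|))%E.
    apply: eq_integral => x _; rewrite -ge0_integralZl//.
    - by apply: eq_integral => t _; rewrite /P/= normrM.
    - exact: measurableT_comp.
  rewrite ge0_integralZr//; last first.
  - exact: integral_ge0.
  - by apply: measurableT_comp => //; exact: measurableT_comp ma'.
  by rewrite lte_mul_pinfty//; [exact: integral_ge0|rewrite ge0_fin_numE//; exact: integral_ge0].
apply: le_integrable iP => //.
- by apply/measurable_EFinP; exact: mK.
- move=> z _ /=; rewrite lee_fin /K normrM ler_piMr// ger0_norm// ?ler0n//.
  by rewrite lern1; case: ltP.
Qed.

Lemma integrable_join (a b c : R) (f : R -> R) : a <= b -> b <= c ->
  mu.-integrable `]a, b[ (EFin \o f) -> mu.-integrable `]b, c[ (EFin \o f) ->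
  mu.-integrable `]a, c[ (EFin \o f).
Proof.
move=> ab bc /integrable_cc_oo fi1 /integrable_cc_oo fi2.
apply/integrable_cc_oo.
move: fi1 fi2 => /integrableP[m1 f1] /integrableP[m2 f2].
have m2' : measurable_fun `]b, c] (EFin \o f).
  by apply: measurable_funS m2 => //; apply: subset_itvr; rewrite bnd_simp.
rewrite (@itv_bndbnd_setU _ _ _ (BRight b))// ?bnd_simp//.
apply/integrableP; split; first exact/measurable_funU.
rewrite ge0_integral_setU//=.
- rewrite lte_add_pinfty//; apply: le_lt_trans f2.
  apply: ge0_subset_integral => //; last by apply: subset_itvr; rewrite bnd_simp.
  by apply/measurable_EFinP; apply: measurableT_comp => //; exact/measurable_EFinP.
- apply/measurable_EFinP; apply: measurableT_comp => //; apply/measurable_EFinP.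
  exact/measurable_funU.
- apply/disj_setPS => y [/=]; rewrite 2!in_itv/= => /andP[_ yx] /andP[].
  by rewrite ltNge yx.
Qed.

Lemma le_Rintegral_itv (a b c d : R) (f : R -> R) : c <= a -> a <= b -> b <= d ->
  mu.-integrable `]c, d[ (EFin \o f) -> (forall x, x \in `]c, d[ -> 0 <= f x) ->
  \int[mu]_(x in `]a, b[) f x <= \int[mu]_(x in `]c, d[) f x.
Proof.
move=> ca ab bd fi f0.
have cb : mu.-integrable `]c, b[ (EFin \o f).
  by apply: integrableS fi => //; apply: subset_itvl; rewrite bnd_simp.
rewrite (Rintegral_chasles _ bd fi) ?(le_trans ca)//.
rewrite (Rintegral_chasles ca ab cb) -addrA addrCA lerDl addr_ge0//.
- apply: Rintegral_ge0 => x /=; rewrite in_itv/= => /andP[cx xa].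
  by apply: f0; rewrite in_itv/= cx; lra.
- apply: Rintegral_ge0 => x /=; rewrite in_itv/= => /andP[cx xa].
  by apply: f0; rewrite in_itv/= xa andbT; lra.
Qed.

End integrals.

(** * The odd primitive and the potential *)

Section primitive.
Context {R : realType}.
Notation mu := (@lebesgue_measure R).
Implicit Types (f : R -> R) (r t x : R).

(** The base point is 0 because [f] need not be integrable near either endpoint; the two branches
    stand for the oriented integral from 0 to [t]. *)
Definition primitive f t : R :=
  if 0 <= t then \int[mu]_(s in `]0, t[) f s else - \int[mu]_(s in `]t, 0[) f s.

(** Vanishes at [r] by construction; its vanishing at [- r] and its evenness come from the oddness
    of [primitive f]. *)
Definition potential r f x : R := \int[mu]_(t in `]x, r[) primitive f t.

Lemma primitive_pos f t : 0 <= t -> primitive f t = \int[mu]_(s in `]0, t[) f s.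
Proof. by rewrite /primitive => ->. Qed.

(** When [f] is integrable on the whole interval, both branches merge into one integral with
    variable upper end, from which continuity up to the endpoints can be read off. *)
Lemma primitiveE f r t : mu.-integrable `]- r, r[ (EFin \o f) -> - r <= t <= r ->
  primitive f t = \int[mu]_(s in `[- r, t]) f s - \int[mu]_(s in `[- r, 0]) f s.
Proof.
move=> fi /andP[rt tr].
have m x : x <= r -> measurable_fun `]- r, x[ f.
  by move=> xr; apply: measurable_sub_oo (integrable_measurable_fun fi).
have i x : x <= r -> mu.-integrable `]- r, x[ (EFin \o f).
  by move=> xr; apply: integrable_sub_oo fi.
rewrite !Rintegral_cc_oo; [|by apply: m; lra|exact: m].
rewrite /primitive; case: ifPn => [t0|]; last rewrite -ltNge => t0.
  rewrite (@Rintegral_chasles _ (- r) 0 t) ?i//; last lra.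
  by rewrite addrAC subrr add0r.
rewrite (@Rintegral_chasles _ (- r) t 0) ?i//; [|lra|lra].
by rewrite opprD addrA subrr add0r.
Qed.

Lemma primitive_continuous_closed f r : 0 < r ->
  mu.-integrable `]- r, r[ (EFin \o f) ->
  {within `[- r, r], continuous (primitive f)}.
Proof.
move=> r0 fi.
have h : {within `[- r, r], continuous (fun t =>
    \int[mu]_(s in `[- r, t]) f s - \int[mu]_(s in `[- r, 0]) f s)}.
  move=> t; apply: cvgB; last exact: cvg_cst.
  by apply: parameterized_integral_continuous; [lra|exact/integrable_cc_oo].
apply: (subspace_eq_continuous _ h) => t; rewrite inE/= in_itv/= => ht.
exact/esym/(primitiveE fi).
Qed.

Lemma primitive_odd f r t : measurable_fun `]- r, r[ f ->
  (forall x, x \in `]- r, r[ -> f (- x) = f x) ->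
  - r <= t <= r -> primitive f (- t) = - primitive f t.
Proof.
move=> mf ev.
wlog t0 : t / 0 <= t => [hw|] tr.
  have [/hw->//|t0] := leP 0 t.
  by rewrite -[in RHS](opprK t) (hw (- t)) ?opprK//; lra.
move: t0; rewrite le_eqVlt => /predU1P[<-|t0].
  rewrite oppr0 /primitive lexx set_itv_ge ?bnd_simp ?ltxx//.
  by rewrite Rintegral_set0 oppr0.
rewrite /primitive oppr_ge0 leNgt t0/= (ltW t0); congr (- _).
rewrite -(@Rintegral_oppr_oo _ 0 t); last first.
  by apply: measurable_sub_oo mf; lra.
rewrite oppr0; apply: eq_Rintegral => x; rewrite inE/= in_itv/= => /andP[h1 h2].
by rewrite ev// in_itv/=; lra.
Qed.

End primitive.

(** * Primitive and potential of an even function integrable against the distance to the boundary *)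

Section weighted.
Context {R : realType}.
Notation mu := (@lebesgue_measure R).
Implicit Types (f : R -> R) (r t x : R).
Variables (r : R) (f : R -> R).
Hypotheses (r0 : 0 < r) (mf : measurable_fun `]- r, r[ f).
Hypothesis ev : forall x : R, x \in `]- r, r[ -> f (- x) = f x.
Hypothesis fint : (\int[mu]_(s in `]0%R, r[) (`|f s| * (r - s))%:E < +oo)%E.

Let mf0 : measurable_fun `]0, r[ f.
Proof. by have rp := r0; apply: measurable_sub_oo mf; lra. Qed.

Lemma integrable_oo_weighted t : t < r -> mu.-integrable `]- t, t[ (EFin \o f).
Proof.
move=> tr; have [t0|t0] := leP t 0.
  by rewrite set_itv_ge ?bnd_simp//; [exact: integrable_set0|rewrite -leNgt; lra].
have i : mu.-integrable `]0, t[ (EFin \o f) by exact: integrable_weight tr mf0 fint.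
apply: (@integrable_join _ _ 0); rewrite ?ltW ?oppr_lt0//.
rewrite -oppr0; apply: eq_integrable (integrable_oppr_oo i) => // x.
by rewrite oppr0 inE/= in_itv/= => /andP[h1 h2]; rewrite ev// in_itv/=; lra.
Qed.

Lemma primitive_continuous t : t \in `]- r, r[ -> {for t, continuous (primitive f)}.
Proof.
rewrite in_itv/= => /andP[h1 h2].
(* [q] is the midpoint of [|t|] and [r]: the point [t] is interior to []- q, q[], on which [f] is
   integrable. *)
pose q := (Num.max t (- t) + r) / 2.
have [tq qr] : (- q < t < q) /\ q < r.
  rewrite /q; case: (leP t (- t)) => h; split; lra.
have q0 : 0 < q by lra.
have := primitive_continuous_closed q0 (integrable_oo_weighted qr).
move=> /continuous_within_itvP[]; first lra.
by move=> + _ _; apply; rewrite in_itv.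
Qed.

Lemma primitive_measurable : measurable_fun `]- r, r[ (primitive f).
Proof.
apply: open_continuous_measurable_fun; first exact: interval_open.
by move=> x; rewrite inE/= => xr; exact: primitive_continuous.
Qed.

Lemma primitive_oddr t : - r <= t <= r -> primitive f (- t) = - primitive f t.
Proof. exact: primitive_odd. Qed.

(** The primitive may be unbounded near [r]; its integrability is the second conclusion of the
    triangle lemma with [b = 1]. *)
Lemma primitive_integrable_pos : mu.-integrable `]0, r[ (EFin \o primitive f).
Proof.
have [||_ i _] := @integral_triangle_bounded _ 0 r 1 f (cst 1) mf0 _ _ fint.
- exact: measurable_cst.
- by move=> t _; rewrite /= normr1.
apply: eq_integrable i => // t; rewrite inE/= in_itv/= => /andP[t0 tr].
by rewrite mul1r/= primitive_pos// ltW.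
Qed.

Let primitive_oppr : mu.-integrable `]- r, 0[ (EFin \o primitive f).
Proof.
have i := integrableN (integrable_oppr_oo primitive_integrable_pos).
rewrite -oppr0; apply: eq_integrable i => // t.
rewrite oppr0 inE/= in_itv/= => /andP[tr t0] /=.
by rewrite primitive_oddr ?opprK//; lra.
Qed.

Lemma primitive_integrable : mu.-integrable `]- r, r[ (EFin \o primitive f).
Proof.
have rp := r0.
by apply: (@integrable_join _ _ 0) => //; [lra|exact: ltW|exact: primitive_integrable_pos].
Qed.

(** By reflection the integral equals its own opposite. This cancellation gives the evenness of [w]
    and removes the boundary constant in [weak_potential]. *)
Lemma Rintegral_primitive_sym t : 0 <= t <= r ->
  \int[mu]_(x in `]- t, t[) primitive f x = 0.
Proof.
move=> /andP[t0 tr].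
have i : mu.-integrable `]- t, t[ (EFin \o primitive f).
  by apply: integrable_sub_oo primitive_integrable; lra.
have m := integrable_measurable_fun i.
have := Rintegral_oppr_oo m; rewrite opprK.
suff -> : \int[mu]_(x in `]- t, t[) primitive f (- x) =
    - \int[mu]_(x in `]- t, t[) primitive f x.
  by move: (Rintegral _ _ _) => I; lra.
rewrite -[RHS]mulN1r -[RHS]RintegralZl//; apply: eq_Rintegral => x.
rewrite inE/= in_itv/= => /andP[h1 h2].
by rewrite mulN1r primitive_oddr//; lra.
Qed.

Let w := potential r f.

Lemma potential_even x : - r <= x <= r -> w (- x) = w x.
Proof.
wlog x0 : x / 0 <= x => [hw|] xr.
  have [/hw->//|x0] := leP 0 x.
  by rewrite -[in RHS](opprK x) (hw (- x)) ?opprK//; lra.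
rewrite /w /potential (@Rintegral_chasles _ (- x) x r) ?Rintegral_primitive_sym ?add0r//; try lra.
by apply: integrable_sub_oo primitive_integrable; lra.
Qed.

(** Moves [x] from the lower to the upper end of integration, the form required by continuity of
    parameter integrals and by the fundamental theorem of calculus. *)
Lemma potential_primitive x : - r <= x <= r ->
  w x = - \int[mu]_(t in `[- r, x]) primitive f t.
Proof.
move=> xr; apply: (addIr (\int[mu]_(t in `[- r, x]) primitive f t)).
rewrite addNr Rintegral_cc_oo; last first.
  by apply: measurable_sub_oo primitive_measurable; lra.
rewrite addrC /w /potential -Rintegral_chasles ?Rintegral_primitive_sym//; try lra.
exact: primitive_integrable.
Qed.

Lemma potential_continuous_closed : {within `[- r, r], continuous w}.
Proof.
have rp := r0.
have h : {within `[- r, r], continuous (fun x => - \int[mu]_(t in `[- r, x]) primitive f t)}.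
  move=> t; apply: cvgN.
  apply: parameterized_integral_continuous; first lra.
  exact/integrable_cc_oo/primitive_integrable.
apply: (subspace_eq_continuous _ h) => t; rewrite inE/= in_itv/= => ht.
exact/esym/potential_primitive.
Qed.

Lemma potential_is_derive x : x \in `]- r, r[ -> is_derive x (1 : R) w (- primitive f x).
Proof.
move=> xr; have := xr; rewrite in_itv/= => /andP[h1 h2].
have [] := @continuous_FTC1_closed _ (primitive f) (- r) x r h2 _ h1 (primitive_continuous xr).
  exact/integrable_cc_oo/primitive_integrable.
move=> dF F'.
have D0 : is_derive x (1 : R) (fun x => \int[mu]_(t in `[- r, x]) primitive f t) (primitive f x).
  by split; [exact: dF|rewrite -derive1E F'].
apply: (near_eq_is_derive _ (is_deriveN D0)).
near=> y; rewrite potential_primitive//.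
have : y \in `]- r, r[ by near: y; exact: near_in_itvoo.
by rewrite in_itv/=; lra.
Unshelve. all: by end_near. Qed.

End weighted.

(** * The weak formulation for the potential *)

Section weak.
Context {R : realType}.
Notation mu := (@lebesgue_measure R).
Implicit Types (f w psi dpsi d2psi b : R -> R) (r t x C : R).

Lemma RintegralN (D : set R) f : measurable D -> mu.-integrable D (EFin \o f) ->
  \int[mu]_(x in D) (- f x) = - \int[mu]_(x in D) f x.
Proof.
move=> mD fi; rewrite -[RHS]mulN1r -[RHS]RintegralZl//.
by apply: eq_Rintegral => x _; rewrite mulN1r.
Qed.

Lemma integrable_ae_bounded (a b : R) (f : R -> R) (M : R) :
  measurable_fun `]a, b[ f ->
  {ae mu, forall x, x \in `]a, b[ -> `|f x| <= M} ->
  mu.-integrable `]a, b[ (EFin \o f).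
Proof.
move=> mf fM; apply/integrableP; split; first exact/measurable_EFinP.
apply: (@le_lt_trans _ _ (\int[mu]_(x in `]a, b[) (cst `|M|%:E x))%E); last first.
  rewrite integral_cst//= lebesgue_measure_itv/= lte_fin.
  by case: ifP => _; rewrite ?mule0 ?ltry// -EFinB -EFinM ltry.
apply: ae_ge0_le_integral => //.
- by apply/measurable_EFinP; exact: measurableT_comp.
- by move=> x _; rewrite lee_fin.
- apply: aeS fM => x /= h xab; rewrite lee_fin.
  by apply: le_trans (h xab) _; exact: ler_norm.
Qed.

Section test_function.
Variables (r : R) (psi dpsi d2psi : R -> R).
Hypotheses (r0 : 0 < r) (W : W2inf_W1inf0 r psi dpsi d2psi).

Lemma test_integrable : mu.-integrable `]- r, r[ (EFin \o d2psi).
Proof.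
case: W => m [M hM] _ _ _; apply: (@integrable_ae_bounded _ _ _ M) => //.
by apply: measurable_funS m => //; exact: subset_itv_oo_cc.
Qed.

Lemma test_dpsi x : - r <= x <= r ->
  dpsi x = dpsi (- r) + \int[mu]_(t in `]- r, x[) d2psi t.
Proof.
move=> xr; case: W => m _ + _ _ => /(_ x); rewrite in_itv/= => /(_ xr) ->.
rewrite Rintegral_cc_oo//; apply: measurable_sub_oo (integrable_measurable_fun test_integrable); lra.
Qed.

Lemma test_dpsi_measurable : measurable_fun `]- r, r[ dpsi.
Proof.
have rp := r0.
have h : {within `[- r, r], continuous (fun x => dpsi (- r) + \int[mu]_(t in `[- r, x]) d2psi t)}.
  move=> t; apply: cvgD; first exact: cvg_cst.
  by apply: parameterized_integral_continuous; [lra|exact/integrable_cc_oo/test_integrable].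
have h2 : measurable_fun `[- r, r] dpsi.
  apply: subspace_continuous_measurable_fun => //.
  apply: (subspace_eq_continuous _ h) => t; rewrite inE/= => ht.
  by case: W => _ _ h1 _ _; exact/esym/h1.
by apply: measurable_funS h2 => //; exact: subset_itv_oo_cc.
Qed.

Lemma test_dpsi_bounded : exists C, forall x, x \in `]- r, r[ -> `|dpsi x| <= C.
Proof.
exists (`|dpsi (- r)| + \int[mu]_(t in `]- r, r[) `|d2psi t|) => x.
rewrite in_itv/= => /andP[h1 h2].
rewrite test_dpsi ?(ltW h1) ?(ltW h2)//.
apply: le_trans (ler_normD _ _) _; rewrite lerD2l.
have i : mu.-integrable `]- r, x[ (EFin \o d2psi).
  by apply: integrable_sub_oo test_integrable; lra.
apply: le_trans (le_normr_Rintegral _ i) _ => //.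
apply: le_Rintegral_itv => //; [exact: ltW|exact: ltW|].
exact: integrable_norm test_integrable.
Qed.

Lemma test_dpsi_integrable : mu.-integrable `]- r, r[ (EFin \o dpsi).
Proof.
have [C hC] := test_dpsi_bounded.
by apply: (@integrable_ae_bounded _ _ _ C); [exact: test_dpsi_measurable|exact: aeW].
Qed.

Lemma test_psi_left x : - r <= x <= r -> psi x = \int[mu]_(t in `]- r, x[) dpsi t.
Proof.
move=> xr; case: W => _ _ _ + [p0 _] => /(_ x); rewrite in_itv/= => /(_ xr) ->.
rewrite p0 add0r Rintegral_cc_oo//.
by apply: measurable_sub_oo test_dpsi_measurable; lra.
Qed.

(** Since [psi r = 0], [psi] can also be integrated from the right endpoint. Each half interval uses
    the endpoint it touches, so that [psi] is seen to decay there like the distance to the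
    boundary. *)
Lemma test_psi_right x : - r <= x <= r -> psi x = - \int[mu]_(t in `]x, r[) dpsi t.
Proof.
move=> xr; have rp := r0; case: W => _ _ _ _ [_ p1].
have : psi r = \int[mu]_(t in `]- r, r[) dpsi t by apply: test_psi_left; lra.
rewrite p1 (@Rintegral_chasles _ (- r) x r); [|lra|lra|exact: test_dpsi_integrable].
by rewrite -test_psi_left// => /eqP; rewrite eq_sym addr_eq0 => /eqP.
Qed.

Variable f : R -> R.
Hypotheses (mf : measurable_fun `]- r, r[ f).
Hypothesis ev : forall x : R, x \in `]- r, r[ -> f (- x) = f x.
Hypothesis fint : (\int[mu]_(s in `]0%R, r[) (`|f s| * (r - s))%:E < +oo)%E.

(** First integration by parts on the positive half only: the weight [r - x] controls [f] at the
    endpoint [r]. The negative half is brought here by reflection. *)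
Let half b phi C : measurable_fun `]0, r[ b ->
  (forall t, t \in `]0, r[ -> `|b t| <= C) ->
  (forall x, x \in `]0, r[ -> phi x = \int[mu]_(t in `]x, r[) b t) ->
  mu.-integrable `]0, r[ (fun x => (f x * phi x)%:E) /\
  \int[mu]_(x in `]0, r[) (f x * phi x) = \int[mu]_(t in `]0, r[) (b t * primitive f t).
Proof.
move=> mb bC phib.
have mf0 : measurable_fun `]0, r[ f by have rp := r0; apply: measurable_sub_oo mf; lra.
have [i _ e] := integral_triangle_bounded mf0 mb bC fint; split.
  by apply: eq_integrable i => // x; rewrite inE/= => /phib ->.
transitivity (\int[mu]_(x in `]0, r[) (f x * \int[mu]_(t in `]x, r[) b t)).
  by apply: eq_Rintegral => x; rewrite inE/= => /phib ->.
rewrite e; apply: eq_Rintegral => t; rewrite inE/= in_itv/= => /andP[t0 tr].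
by rewrite primitive_pos// ltW.
Qed.

Let primi : mu.-integrable `]- r, r[ (EFin \o primitive f).
Proof. exact: primitive_integrable. Qed.

Let dpsi_primi : mu.-integrable `]- r, r[ (fun x => (dpsi x * primitive f x)%:E).
Proof.
have [C hC] := test_dpsi_bounded.
have := @integrableMr _ _ _ mu _ (measurable_itv _) dpsi (EFin \o primitive f)
  test_dpsi_measurable _ primi; apply.
exists C; split; first exact: num_real.
by move=> M CM x /= xr; apply: le_trans (ltW CM); exact: hC.
Qed.

Let weak1 : mu.-integrable `]- r, r[ (fun x => (f x * psi x)%:E) /\
  \int[mu]_(x in `]- r, r[) (f x * psi x) =
  - \int[mu]_(x in `]- r, r[) (dpsi x * primitive f x).
Proof.
have rp := r0.
have [C hC] := test_dpsi_bounded.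
have [|t|x|i1 e1] := @half (fun x => - dpsi x) psi C.
- apply: measurableT_comp => //.
  by apply: measurable_sub_oo test_dpsi_measurable; lra.
- rewrite in_itv/= => /andP[h1 h2]; rewrite normrN; apply: hC; rewrite in_itv/=; lra.
- rewrite in_itv/= => /andP[h1 h2].
  rewrite RintegralN//; first by apply: test_psi_right; lra.
  by apply: integrable_sub_oo test_dpsi_integrable; lra.
have md : measurable_fun `]- r, 0[ dpsi by apply: measurable_sub_oo test_dpsi_measurable; lra.
(* The reflected function [psi (- x)] has derivative [- dpsi (- x)] and vanishes at [r], hence it is
   the integral of [dpsi (- t)] from [x] to [r]. *)
have [|t|x|i2 e2] := @half (fun x => dpsi (- x)) (fun x => psi (- x)) C.
- by have := measurable_fun_oppr_oo md; rewrite oppr0 opprK.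
- by rewrite in_itv/= => /andP[h1 h2]; apply: hC; rewrite in_itv/=; lra.
- rewrite in_itv/= => /andP[h1 h2]; rewrite test_psi_left; last lra.
  rewrite -Rintegral_oppr_oo ?opprK//.
  by apply: measurable_sub_oo test_dpsi_measurable; lra.
have i3 : mu.-integrable `]- r, 0[ (EFin \o (fun x => f x * psi x)).
  have := integrable_oppr_oo i2; rewrite oppr0; apply: eq_integrable => // x.
  rewrite inE/= in_itv/= => /andP[h1 h2]; rewrite opprK ev// in_itv/=; lra.
have i : mu.-integrable `]- r, r[ (fun x => (f x * psi x)%:E).
  by apply: (@integrable_join _ _ 0 _ (fun x => f x * psi x)) => //; lra.
split; first exact: i.
rewrite (@Rintegral_chasles _ (- r) 0 r)//; [|lra|lra].
have -> : \int[mu]_(x in `]- r, r[) (dpsi x * primitive f x) =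
    \int[mu]_(x in `]- r, 0[) (dpsi x * primitive f x) +
    \int[mu]_(x in `]0, r[) (dpsi x * primitive f x).
  by apply: Rintegral_chasles; [lra|lra|exact: dpsi_primi].
have j1 : mu.-integrable `]0, r[ (EFin \o (fun x => dpsi x * primitive f x)).
  by apply: integrable_sub_oo dpsi_primi; lra.
have j2 : mu.-integrable `]- r, 0[ (EFin \o (fun x => dpsi x * primitive f x)).
  by apply: integrable_sub_oo dpsi_primi; lra.
rewrite opprD; congr (_ + _); last first.
  by rewrite e1 -RintegralN//; apply: eq_Rintegral => x _; rewrite mulNr.
rewrite -[LHS](Rintegral_oppr_oo (integrable_measurable_fun i3)).
rewrite -[X in _ = - X](Rintegral_oppr_oo (integrable_measurable_fun j2)).
rewrite oppr0 opprK.
transitivity (\int[mu]_(x in `]0, r[) (f x * psi (- x))).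
  apply: eq_Rintegral => x; rewrite inE/= in_itv/= => /andP[h1 h2].
  by rewrite ev// in_itv/=; lra.
rewrite e2 -RintegralN//; last first.
  by have := integrable_oppr_oo j2; rewrite oppr0 opprK.
apply: eq_Rintegral => x; rewrite inE/= in_itv/= => /andP[h1 h2].
by rewrite (primitive_odd mf ev) ?mulrN ?opprK//; lra.
Qed.

Lemma weak_potential :
  [/\ mu.-integrable `]- r, r[ (fun x => (f x * psi x)%:E),
      mu.-integrable `]- r, r[ (fun x => (potential r f x * d2psi x)%:E) &
      \int[mu]_(x in `]- r, r[) (f x * psi x) =
      - \int[mu]_(x in `]- r, r[) (potential r f x * d2psi x)].
Proof.
have rp := r0.
have [i e] := weak1.
have [i2 _ e2] := integral_triangle_integrable test_integrable primi.
split => //.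
  by apply: eq_integrable i2 => // x _; rewrite mulrC.
rewrite e; congr (- _).
transitivity (\int[mu]_(x in `]- r, r[) (d2psi x * \int[mu]_(t in `]x, r[) primitive f t)); last first.
  by apply: eq_Rintegral => x _; rewrite mulrC.
rewrite e2.
(* Integrating [d2psi] from [- r] gives [dpsi t - dpsi (- r)]; the constant then meets the integral
   of the odd primitive over []- r, r[], which is 0. *)
have -> : \int[mu]_(t in `]- r, r[) (primitive f t * \int[mu]_(x in `]- r, t[) d2psi x) =
    \int[mu]_(t in `]- r, r[) (dpsi t * primitive f t - dpsi (- r) * primitive f t).
  apply: eq_Rintegral => t; rewrite inE/= in_itv/= => /andP[h1 h2].
  rewrite (@test_dpsi t) ?(ltW h1) ?(ltW h2)//; ring.
have -> : \int[mu]_(t in `]- r, r[) (dpsi t * primitive f t - dpsi (- r) * primitive f t) =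
    \int[mu]_(t in `]- r, r[) (dpsi t * primitive f t) -
    \int[mu]_(t in `]- r, r[) (dpsi (- r) * primitive f t).
  have j : mu.-integrable `]- r, r[ (EFin \o (fun t => dpsi (- r) * primitive f t)).
    by have := integrableZl (mu := mu) (measurable_itv `]- r, r[) (dpsi (- r)) primi.
  exact: RintegralB.
rewrite RintegralZl// (Rintegral_primitive_sym r0 mf ev fint) ?mulr0 ?subr0 ?lexx ?(ltW rp)//.
Qed.

End test_function.
End weak.

(** * Test functions and concave functions on dense sets *)

Section test_of_second_derivative.
Context {R : realType}.
Notation mu := (@lebesgue_measure R).
Implicit Types (f g k : R -> R) (r t x : R).

Lemma Rintegral_shrink (a b x : R) k : a <= x <= b ->
  mu.-integrable `]a, b[ (EFin \o k) ->
  \int[mu]_(t in `[a, x]) k t = \int[mu]_(t in `]a, x[) k t.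
Proof.
move=> /andP[ax xb] ki; apply: Rintegral_cc_oo.
by apply: measurable_sub_oo (integrable_measurable_fun ki).
Qed.

(** Any bounded measurable [k] may serve as second derivative. The constant [c] is the slope at
    [- r], and the only remaining constraint, zero mean of [K], says that [psi r = 0]. *)
Lemma W2inf_of_second_derivative r (k : R -> R) (M c : R) : 0 < r ->
  measurable_fun setT k -> (forall x, `|k x| <= M) ->
  let K x := c + \int[mu]_(t in `[- r, x]) k t in
  \int[mu]_(t in `[- r, r]) K t = 0 ->
  W2inf_W1inf0 r (fun x => \int[mu]_(t in `[- r, x]) K t) K k.
Proof.
move=> r0 mk kM K K0; split.
- exact: measurable_funTS.
- by exists M; apply: aeW => x _.
- by move=> x _; rewrite {2}/K set_itv1 Rintegral_set1 addr0.
- by move=> x _; rewrite set_itv1 Rintegral_set1 add0r.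
- by rewrite set_itv1 Rintegral_set1.
Qed.

Lemma ae_pick (P : R -> Prop) (x y : R) : x < y ->
  {ae mu, forall t, t \in `]x, y[ -> P t} -> exists2 t, t \in `]x, y[ & P t.
Proof.
move=> xy [A [mA A0 PA]]; apply: contrapT => h.
have sub : `]x, y[%classic `<=` A.
  move=> t xyt; apply: PA => /= hP; apply: h; exists t => //; exact: hP.
have : mu `]x, y[%classic = 0%E.
  by apply/eqP; rewrite -measure_le0 -A0 le_measure ?inE.
rewrite lebesgue_measure_itv/= lte_fin xy -EFinB => -[]; lra.
Qed.

End test_of_second_derivative.

(** * Extension from a subset under a modulus of continuity *)

Section mcshane.
Context {R : realType}.
Implicit Types (S : set R) (g phi : R -> R).

(** McShane's extension, the infimum over [y] in [S] of [g y + |phi x - phi y|], for the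
    pseudo-distance induced by [phi]. Nonnegativity of [g] bounds the infimum from below and passes
    to the extension. *)
Lemma mcshane S g phi (s0 : R) : S s0 -> (forall x, S x -> 0 <= g x) ->
  (forall x y, S x -> S y -> `|g x - g y| <= `|phi x - phi y|) ->
  exists h : R -> R, [/\ forall x, S x -> h x = g x, forall x, 0 <= h x &
    forall x y, `|h x - h y| <= `|phi x - phi y|].
Proof.
move=> Ss0 g0 gphi.
pose E x : set R := [set z | exists2 y, S y & z = g y + `|phi x - phi y|].
have E0 x z : E x z -> 0 <= z by move=> [y Sy ->]; rewrite addr_ge0 ?g0.
have En x : E x !=set0 by exists (g s0 + `|phi x - phi s0|), s0.
have El x : has_lbound (E x) by exists 0 => z /E0.
have le x y : inf (E x) <= inf (E y) + `|phi x - phi y|.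
  rewrite -lerBlDr; apply: lb_le_inf => // z [s Ss ->]; rewrite lerBlDr.
  apply: (@le_trans _ _ (g s + `|phi x - phi s|)); first by apply: ge_inf => //; exists s.
  by rewrite -addrA lerD2l addrC ler_distD.
exists (fun x => inf (E x)); split.
- move=> x Sx; apply/eqP; rewrite eq_le; apply/andP; split.
    by apply: ge_inf => //; exists x => //; rewrite subrr normr0 addr0.
  apply: lb_le_inf => // z [y Sy ->]; rewrite -lerBlDl.
  exact: le_trans (ler_norm _) (gphi _ _ Sx Sy).
- by move=> x; apply: lb_le_inf => // z /E0.
- move=> x y; rewrite ler_norml; apply/andP; split.
    by rewrite lerNl opprB lerBlDl distrC; exact: le.
  by rewrite lerBlDl; exact: le.
Qed.

End mcshane.

Section concave_on_dense.
Context {R : realType}.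
Implicit Types (S : set R) (g : R -> R).

(** Three-point inequality cleared of denominators. All three points lie in [S], which will be a set
    of full measure, not a convex one. *)
Definition concave_on S g := forall a b c : R, S a -> S b -> S c -> a < b -> b < c ->
  (c - b) * g a + (b - a) * g c <= (c - a) * g b.

Section right_slope.
Variables (r : R) (S : set R) (g : R -> R).
Hypotheses (dense : forall x y : R, - r <= x -> x < y -> y <= r -> exists2 s, S s & x < s < y).
Hypotheses (g0 : forall x, S x -> 0 <= g x) (cg : concave_on S g).
Hypothesis Sr : forall x, S x -> - r < x < r.

(** Says that [g x / (r - x)] is nondecreasing: in the concavity inequality for [a < b < c], drop
    the term [g c >= 0] and let [c] tend to [r] inside [S]. *)
Lemma concave_ratio_right (a b : R) : S a -> S b -> a < b -> (r - b) * g a <= (r - a) * g b.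
Proof.
move=> Sa Sb ab; rewrite leNgt; apply/negP => H.
have ga := g0 Sa; have gb := g0 Sb.
have := Sr Sb; have := Sr Sa => /andP[a1 a2] /andP[b1 b2].
(* How close to [r] the point [c] must be: dropping [g c] bounds the gap
   [(r - b) * g a - (r - a) * g b] by [(r - c) * g a]. The [+ 1] keeps the denominator positive. *)
pose d := ((r - b) * g a - (r - a) * g b) / (g a + 1).
have d0 : 0 < d by rewrite /d divr_gt0; lra.
have dE : d * (g a + 1) = (r - b) * g a - (r - a) * g b by rewrite /d divfK//; apply/eqP; lra.
have [||c Sc /andP[c1 c2]] := @dense (Num.max b (r - d)) r _ _ (lexx r).
- by rewrite le_max; apply/orP; left; lra.
- by rewrite gt_max; apply/andP; split; lra.
move: c1; rewrite gt_max => /andP[bc rdc].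
have := cg Sa Sb Sc ab bc; have gc := g0 Sc.
have : 0 <= (b - a) * g c by apply: mulr_ge0; lra.
move: dE rdc; move: d d0 => d d0 dE rdc h1 h2.
have : (r - c) * (g a + 1) < d * (g a + 1) by rewrite ltr_pM2r; lra.
have : 0 <= (r - c) * g b by apply: mulr_ge0; lra.
lra.
Qed.
End right_slope.

Lemma concave_ratio_left (r : R) S g :
  (forall x y : R, - r <= x -> x < y -> y <= r -> exists2 s, S s & x < s < y) ->
  (forall x, S x -> 0 <= g x) -> concave_on S g -> (forall x, S x -> - r < x < r) ->
  forall a b : R, S a -> S b -> a < b -> (r + a) * g b <= (r + b) * g a.
Proof.
move=> dense g0 cg Sr a b Sa Sb ab.
have := @concave_ratio_right r (fun x => S (- x)) (fun x => g (- x)) _ _ _ _ (- b) (- a).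
rewrite /= !opprK; apply => //.
- move=> x y rx xy yr; have [|||s Ss sxy] := @dense (- y) (- x); try lra.
  by exists (- s); rewrite ?opprK//; lra.
- by move=> x /g0.
- move=> u v w Su Sv Sw uv vw; have := @cg (- w) (- v) (- u) Sw Sv Su; lra.
- by move=> x /Sr; lra.
- lra.
Qed.

(** From [q * x <= p * y], [x - y <= M * (p - q) / p]; the extra factor [c / q >= 1] turns this into
    an increment of a reciprocal, so that the bound becomes a difference of values of one
    function. *)
Lemma reciprocal_bound (M c p q x y : R) : 0 < q -> q < p -> q <= c -> 0 <= M ->
  x <= M -> q * x <= p * y -> x - y <= c * M * (q^-1 - p^-1).
Proof.
move=> q0 qp qc M0 xM h.
have p0 : 0 < p by exact: lt_trans qp.
have -> : c * M * (q^-1 - p^-1) = (c / q) * (M * (p - q)) / p.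
  by field; rewrite !gt_eqF.
rewrite ler_pdivlMr//.
have : M * (p - q) <= (c / q) * (M * (p - q)).
  by rewrite ler_peMl ?mulr_ge0 ?subr_ge0 ?(ltW qp)// ler_pdivlMr// mul1r.
apply: le_trans.
have : 0 <= (M - x) * (p - q) by rewrite mulr_ge0 ?subr_ge0 ?(ltW qp).
rewrite mulrBl; lra.
Qed.

(** The two ratio inequalities bound the increments of [g] by those of a function [phi] continuous
    inside the interval and infinite at its ends; [mcshane] does the rest. *)
Lemma concave_extension (r : R) S g : 0 < r ->
  (forall x y : R, - r <= x -> x < y -> y <= r -> exists2 s, S s & x < s < y) ->
  (forall x, S x -> 0 <= g x) -> concave_on S g -> (forall x, S x -> - r < x < r) ->
  exists h : R -> R, [/\ forall x, S x -> h x = g x, forall x, 0 <= h x &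
    forall x, - r < x < r -> {for x, continuous h}].
Proof.
move=> r0 dense g0 cg Sr.
have [|||s0 Ss0 _] := dense (- r) r; [lra|lra|lra|].
have Ri := concave_ratio_right dense g0 cg Sr.
have Li := concave_ratio_left dense g0 cg Sr.
have /andP[s1 s2] := Sr _ Ss0.
(* Upper bound for [g] on [S] from the ratio inequalities against [s0]: left of [s0] the factor is
   [(r - x) / (r - s0)], right of it [(r + x) / (r + s0)], with numerators below [2 * r]. The sum
   covers both cases. *)
pose M := g s0 * (2 * r / (r + s0) + 2 * r / (r - s0)).
have p1 : 0 <= 2 * r / (r + s0) by rewrite divr_ge0//; lra.
have p2 : 0 <= 2 * r / (r - s0) by rewrite divr_ge0//; lra.
have gs0 := g0 _ Ss0.
have gM x : S x -> g x <= M.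
  move=> Sx; have /andP[x1 x2] := Sr _ Sx; have gx := g0 _ Sx.
  rewrite /M mulrDr; have q1 := mulr_ge0 gs0 p1; have q2 := mulr_ge0 gs0 p2.
  have [xs|xs|->] := ltgtP x s0.
  - have h := Ri _ _ Sx Ss0 xs.
    suff : g x <= g s0 * (2 * r / (r - s0)) by lra.
    rewrite !mulrA ler_pdivlMr; last lra.
    have : 0 <= (r + x) * g s0 by apply: mulr_ge0; lra.
    lra.
  - have h := Li _ _ Ss0 Sx xs.
    suff : g x <= g s0 * (2 * r / (r + s0)) by lra.
    rewrite !mulrA ler_pdivlMr; last lra.
    have : 0 <= (r - x) * g s0 by apply: mulr_ge0; lra.
    lra.
  - suff : g s0 <= g s0 * (2 * r / (r + s0)) by lra.
    by rewrite ler_peMr// ler_pdivlMr; lra.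
have M0 : 0 <= M by apply: le_trans (gM _ Ss0).
(* the slope of g at x lies between - M / (r - x) and M / (r + x), and |phi'| dominates both *)
pose phi (x : R) := 2 * r * M * ((r - x)^-1 - (r + x)^-1).
have lt_phi a b : S a -> S b -> a < b -> `|g a - g b| <= phi b - phi a.
  move=> Sa Sb ab; have /andP[a1 a2] := Sr _ Sa; have /andP[b1 b2] := Sr _ Sb.
  have h1 := Ri _ _ Sa Sb ab; have h2 := Li _ _ Sa Sb ab.
  have Ma := gM _ Sa; have Mb := gM _ Sb.
  have ga := g0 _ Sa; have gb := g0 _ Sb.
  have k1 : g a - g b <= 2 * r * M * ((r - b)^-1 - (r - a)^-1).
    by apply: reciprocal_bound => //; lra.
  have k2 : g b - g a <= 2 * r * M * ((r + a)^-1 - (r + b)^-1).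
    by apply: reciprocal_bound => //; lra.
  (* Taking [x = y = 0] in [reciprocal_bound] only records that each of the two increments is
     nonnegative, so each is at most their sum [phi b - phi a]. *)
  have k3 : 0 - 0 <= 2 * r * M * ((r - b)^-1 - (r - a)^-1).
    by apply: reciprocal_bound => //; lra.
  have k4 : 0 - 0 <= 2 * r * M * ((r + a)^-1 - (r + b)^-1).
    by apply: reciprocal_bound => //; lra.
  have -> : phi b - phi a = 2 * r * M * ((r - b)^-1 - (r - a)^-1) +
      2 * r * M * ((r + a)^-1 - (r + b)^-1) by rewrite /phi; ring.
  move: k1 k2 k3 k4; clear; move: (_ * _) (_ * _) => u v.
  by rewrite subrr => k1 k2 k3 k4; rewrite ler_norml; apply/andP; split; lra.
have [h [hg h0 hphi]] : exists h : R -> R, [/\ forall x, S x -> h x = g x, forall x, 0 <= h x &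
    forall x y, `|h x - h y| <= `|phi x - phi y|].
  apply: (mcshane Ss0 g0) => x y Sx Sy.
  have [xy|xy|->] := ltgtP x y; last by rewrite !subrr.
  - by rewrite [leRHS]distrC; apply: le_trans (lt_phi _ _ Sx Sy xy) (ler_norm _).
  - by rewrite [leLHS]distrC; apply: le_trans (lt_phi _ _ Sy Sx xy) (ler_norm _).
exists h; split => // x /andP[x1 x2].
have cphi : phi y @[y --> x] --> phi x.
  apply: cvgMr; apply: cvgB.
  - by apply: cvgV; [rewrite subr_eq0; apply/eqP; lra|apply: cvgB; [exact: cvg_cst|exact: cvg_id]].
  - by apply: cvgV; [apply/eqP; lra|apply: cvgD; [exact: cvg_cst|exact: cvg_id]].
apply/cvgrPdist_le => e e0.
have /cvgrPdist_le/(_ _ e0) := cphi.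
by apply: filterS => y; apply: le_trans.
Qed.

(* mirror points a and -a turn concavity into monotonicity on the positive side *)
Lemma concave_even_nonincreasing S g (a b : R) : concave_on S g -> 0 < a -> a < b ->
  S (- b) -> S a -> S b -> g (- b) = g b -> g b <= g a.
Proof.
move=> cg a0 ab Snb Sa Sb gb.
have := @cg (- b) a b Snb Sa Sb; rewrite gb => h.
suff : (2 * b) * g b <= (2 * b) * g a by rewrite ler_pM2l; lra.
have : - b < a by lra.
by move=> /h /(_ ab); lra.
Qed.

End concave_on_dense.

(** * Nonnegativity of superharmonic functions *)

Section superharmonic.
Context {R : realType}.
Notation mu := (@lebesgue_measure R).
Implicit Types (k : R -> R) (a b c t x e : R).

Lemma continuous_integrable_oo (a b : R) (k : R -> R) :
  {within `[a, b], continuous k} -> mu.-integrable `]a, b[ (EFin \o k).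
Proof.
by move=> ck; apply/integrable_cc_oo/continuous_compact_integrable => //; exact: segment_compact.
Qed.

Lemma integrable_Rintegral (a b : R) (k : R -> R) : a <= b ->
  mu.-integrable `]a, b[ (EFin \o k) ->
  mu.-integrable `]a, b[ (EFin \o (fun x => \int[mu]_(t in `[a, x]) k t)).
Proof.
move=> ab ki; apply: continuous_integrable_oo.
by apply: parameterized_integral_continuous => //; exact/integrable_cc_oo.
Qed.

Lemma integrable_cst_oo (a b c : R) : mu.-integrable `]a, b[ (EFin \o cst c).
Proof. by apply: continuous_integrable_oo; apply: continuous_subspaceT => x; exact: cvg_cst. Qed.

Lemma Rintegral_cst_oo (a b c : R) : a <= b ->
  \int[mu]_(t in `]a, b[) c = c * (b - a).
Proof.
move=> ab; rewrite Rintegral_cst//= lebesgue_measure_itv/= lte_fin.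
by move: ab; rewrite le_eqVlt => /predU1P[->|ab]; rewrite ?ltxx ?subrr//= ab -EFinB.
Qed.

Lemma integrable_mul_indic (a b : R) (k : R -> R) (E : set R) : measurable E ->
  mu.-integrable `]a, b[ (EFin \o k) ->
  mu.-integrable `]a, b[ (EFin \o (fun x => k x * \1_E x)).
Proof.
move=> mE ki.
have := @integrableMl _ _ _ mu _ (measurable_itv _) (EFin \o k) (\1_E) ki.
apply; first exact: measurable_indic.
exists 1; split; first exact: num_real.
move=> M M1 x _; apply: le_trans (ltW M1).
by rewrite indicE; case: (x \in E); rewrite ?normr1 ?normr0.
Qed.

Variable r : R.
Hypothesis r0 : 0 < r.
Variable g : R -> R.
Hypothesis gi : mu.-integrable `]- r, r[ (EFin \o g).
Hypothesis H : forall psi dpsi d2psi : R -> R, W2inf_W1inf0 r psi dpsi d2psi ->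
  (forall x : R, x \in `]- r, r[ -> 0 <= psi x) ->
  \int[mu]_(x in `]- r, r[) (g x * d2psi x) <= 0.

Let indic_integrable (E : set R) : measurable E -> mu.-integrable `]- r, r[ (EFin \o \1_E).
Proof.
move=> mE; apply: (@integrable_ae_bounded _ _ _ _ 1); first exact: measurable_indic.
by apply: aeW => x _; rewrite indicE; case: (x \in E); rewrite ?normr1 ?normr0.
Qed.

(** The solution of [psi'' = - 1_E] with zero boundary values is concave, hence nonnegative. *)
Let indic_test (E : set R) : measurable E ->
  exists psi dpsi, W2inf_W1inf0 r psi dpsi (fun x => - \1_E x) /\
    forall x : R, x \in `]- r, r[ -> 0 <= psi x.
Proof.
move=> mE; have rp := r0.
have iE := indic_integrable mE.
have iE' : mu.-integrable `]- r, r[ (EFin \o (fun t => - \1_E t)).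
  by have := integrableN iE.
pose N (x : R) := \int[mu]_(t in `[- r, x]) \1_E t.
have iN : mu.-integrable `]- r, r[ (EFin \o N) by apply: integrable_Rintegral => //; lra.
have Nmono x y : - r <= x -> x <= y -> y <= r -> N x <= N y.
  move=> h1 h2 h3; rewrite /N.
  rewrite (@Rintegral_shrink _ _ r) ?h1 ?(le_trans h2)//.
  rewrite (@Rintegral_shrink _ _ r) ?(le_trans h1)//.
  by apply: le_Rintegral_itv => //; apply: integrable_sub_oo iE.
pose J x := \int[mu]_(t in `]- r, x[) N t.
(* The slope at [- r] for which [psi x = c * (x + r) - J x] vanishes at [r]. *)
pose c := J r / (2 * r).
pose K (x : R) := c + \int[mu]_(t in `[- r, x]) (- \1_E t).
have KE x : - r <= x <= r -> K x = c - N x.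
  move=> xr; rewrite /K /N (Rintegral_shrink xr iE') (Rintegral_shrink xr iE).
  by rewrite RintegralN//; apply: integrable_sub_oo iE; lra.
have iK : mu.-integrable `]- r, r[ (EFin \o (fun x => c - N x)).
  by apply: integrableB_fin => //; exact: (integrable_cst_oo (- r) r c).
have mK : measurable_fun `]- r, r[ K.
  apply: eq_measurable_fun (integrable_measurable_fun iK) => x.
  by rewrite inE/= in_itv/= => /andP[h1 h2]; rewrite KE// ?ltW//.
have psiE x : - r <= x <= r -> \int[mu]_(t in `[- r, x]) K t = c * (x + r) - J x.
  move=> /andP[h1 h2]; rewrite Rintegral_cc_oo; last by apply: measurable_sub_oo mK.
  have -> : \int[mu]_(t in `]- r, x[) K t = \int[mu]_(t in `]- r, x[) (c - N t).
    by apply: eq_Rintegral => t; rewrite inE/= in_itv/= => /andP[t1 t2]; rewrite KE//; lra.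
  rewrite RintegralB//; last first.
    by apply: integrable_sub_oo iN.
    exact: integrable_cst_oo.
  by rewrite Rintegral_cst_oo// opprK.
exists (fun x => \int[mu]_(t in `[- r, x]) K t), K; split.
  apply: (@W2inf_of_second_derivative _ _ _ 1) => //.
  - by apply: measurableT_comp => //; exact: measurable_indic.
  - by move=> x; rewrite normrN indicE; case: (x \in E); rewrite ?normr1 ?normr0.
  rewrite -/K psiE; last lra.
  by rewrite /c; field; apply/eqP; lra.
move=> x; rewrite in_itv/= => /andP[h1 h2]; rewrite psiE; last lra.
(* [J] is convex since [N] is nondecreasing. [J1] and [J2] compare [J] at the two endpoints with its
   tangent at [x]; weighted by [r - x] and [x + r] they put [J x] below the chord, which is
   [c * (x + r)]. *)
have J1 : J x <= (x + r) * N x.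
  have -> : (x + r) * N x = \int[mu]_(t in `]- r, x[) N x.
    by rewrite Rintegral_cst_oo ?opprK 1?mulrC//; lra.
  apply: le_Rintegral => //.
  - by apply: integrable_sub_oo iN; lra.
  - exact: integrable_cst_oo.
  - by move=> t /=; rewrite in_itv/= => /andP[t1 t2]; apply: Nmono; lra.
have J2 : (r - x) * N x <= J r - J x.
  rewrite /J (@Rintegral_chasles _ (- r) x r) ?(ltW h1) ?(ltW h2)//.
  rewrite addrAC subrr add0r.
  have -> : (r - x) * N x = \int[mu]_(t in `]x, r[) N x.
    by rewrite Rintegral_cst_oo 1?mulrC//; lra.
  apply: le_Rintegral => //.
  - exact: integrable_cst_oo.
  - by apply: integrable_sub_oo iN; lra.
  - by move=> t /=; rewrite in_itv/= => /andP[t1 t2]; apply: Nmono; lra.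
have -> : c * (x + r) = (J r * (x + r)) / (2 * r) by rewrite /c mulrAC.
rewrite subr_ge0 ler_pdivlMr; last lra.
have : 0 <= (r - x) * ((x + r) * N x - J x) by rewrite mulr_ge0//; lra.
have : 0 <= (x + r) * (J r - J x - (r - x) * N x) by rewrite mulr_ge0//; lra.
move: (J x) (J r) (N x) => u v n; lra.
Qed.

Let integral_indic_ge0 (E : set R) : measurable E ->
  0 <= \int[mu]_(x in `]- r, r[) (g x * \1_E x).
Proof.
move=> mE; have [psi [dpsi [W psi0]]] := indic_test mE.
have := H W psi0.
have -> : \int[mu]_(x in `]- r, r[) (g x * - \1_E x) =
    - \int[mu]_(x in `]- r, r[) (g x * \1_E x).
  rewrite -RintegralN//; first by apply: eq_Rintegral => x _; rewrite mulrN.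
  exact: integrable_mul_indic.
by rewrite oppr_le0.
Qed.

Lemma superharmonic_ge0 : {ae mu, forall x, x \in `]- r, r[ -> 0 <= g x}.
Proof.
have mg := integrable_measurable_fun gi.
pose E : set R := `]- r, r[ `&` [set x | g x < 0].
have mE : measurable E.
  have -> : E = `]- r, r[ `&` g @^-1` `]-oo, 0[.
    by apply/seteqP; split => x /=; rewrite /E/= [_ \in `]-oo, _[]in_itv.
  exact: mg.
have := integral_indic_ge0 mE.
have -> : \int[mu]_(x in `]- r, r[) (g x * \1_E x) = \int[mu]_(x in E) g x.
  rewrite {2}/E Rintegral_mkcondr; apply: eq_Rintegral => x.
  rewrite inE => xr; rewrite patchE indicE.
  case: ifPn => [|] xE.
    by rewrite mem_set ?mulr1//; split => //; exact: set_mem.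
  rewrite memNset ?mulr0// => -[_ gx]; move: xE; rewrite notin_setE; exact.
move=> h.
have iE : mu.-integrable E (EFin \o g) by apply: integrableS gi => // x [].
(* On [E], [|g| = - g], so the nonnegative integral of [g] over [E] forces that of [|g|] to be 0. *)
have a0 : (\int[mu]_(x in E) `|(EFin \o g) x| = 0)%E.
  have fn : (\int[mu]_(x in E) `|(EFin \o g) x|)%E \is a fin_num.
    rewrite ge0_fin_numE; last exact: integral_ge0.
    by case/integrableP : iE.
  rewrite -(fineK fn); congr EFin; apply/eqP; rewrite eq_le; apply/andP; split; last first.
    by apply: fine_ge0; exact: integral_ge0.
  have -> : fine (\int[mu]_(x in E) `|(EFin \o g) x|)%E = - \int[mu]_(x in E) g x.
    rewrite -RintegralN//; apply: eq_Rintegral => x; rewrite inE => -[_ /= gx].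
    by rewrite ltr0_norm.
  by rewrite oppr_le0.
have m : measurable_fun E (EFin \o g) by case/integrableP : iE.
have /(ae_eq_integral_abs mu mE m) := a0.
apply: aeS => x /= hx xr; rewrite leNgt; apply/negP => gx.
have : E x by split.
by move=> /hx [] gx0; move: gx; rewrite gx0 ltxx.
Qed.

End superharmonic.

(** * Tent test functions *)

Section tent.
Context {R : realType}.
Notation mu := (@lebesgue_measure R).
Implicit Types (k : R -> R) (a b c t x y z e : R).

(** The positive part, written with the absolute value so that its continuity follows from that of
    the norm. *)
Definition pospart x : R := (x + `|x|) / 2.
Local Notation p := pospart.

Lemma pospart_ge0 x : 0 <= x -> p x = x.
Proof. by move=> x0; rewrite /p ger0_norm//; field. Qed.

Lemma pospart_le0 x : x <= 0 -> p x = 0.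
Proof. by move=> x0; rewrite /p ler0_norm// subrr mul0r. Qed.

Lemma pospart_continuous a : continuous (fun t => p (t - a)).
Proof.
move=> t; apply: cvgMl; apply: cvgD; last apply: cvg_norm.
- by apply: cvgB; [exact: cvg_id|exact: cvg_cst].
- by apply: cvgB; [exact: cvg_id|exact: cvg_cst].
Qed.

Lemma pospart_integrable (l x a : R) : mu.-integrable `]l, x[ (EFin \o (fun t => p (t - a))).
Proof.
by apply: continuous_integrable_oo; apply: continuous_subspaceT; exact: pospart_continuous.
Qed.

(* the two halves of the square of side x - a have the same area by Fubini *)
Lemma Rintegral_ramp a x : a <= x ->
  \int[mu]_(t in `]a, x[) (t - a) = (x - a) ^+ 2 / 2.
Proof.
move=> ax.
have i1 := @integrable_cst_oo R a x 1.
have [_ i e] := integral_triangle_integrable i1 i1.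
have e1 : \int[mu]_(t in `]a, x[) (t - a) = \int[mu]_(t in `]a, x[) (x - t).
  transitivity (\int[mu]_(t in `]a, x[) (cst 1 t * \int[mu]_(s in `]a, t[) cst 1 s)).
    apply: eq_Rintegral => t; rewrite inE/= in_itv/= => /andP[t1 t2].
    by rewrite (Rintegral_cst_oo 1 (ltW t1)) /= !mul1r.
  rewrite -e; apply: eq_Rintegral => t; rewrite inE/= in_itv/= => /andP[t1 t2].
  by rewrite (Rintegral_cst_oo 1 (ltW t2)) /= !mul1r.
have j1 : mu.-integrable `]a, x[ (EFin \o (fun t => t - a)).
  apply: continuous_integrable_oo; apply: continuous_subspaceT => t.
  by apply: cvgB; [exact: cvg_id|exact: cvg_cst].
have j2 : mu.-integrable `]a, x[ (EFin \o (fun t => x - t)).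
  apply: continuous_integrable_oo; apply: continuous_subspaceT => t.
  by apply: cvgB; [exact: cvg_cst|exact: cvg_id].
have : \int[mu]_(t in `]a, x[) ((t - a) + (x - t)) = (x - a) * (x - a).
  rewrite -(Rintegral_cst_oo (x - a) ax); apply: eq_Rintegral => t _; ring.
have -> : \int[mu]_(t in `]a, x[) ((t - a) + (x - t)) =
    \int[mu]_(t in `]a, x[) (t - a) + \int[mu]_(t in `]a, x[) (x - t).
  exact: RintegralD.
rewrite -e1; move: (Rintegral _ _ _) => I h.
by rewrite expr2 -h; field.
Qed.

Lemma Rintegral_pospart (l x a : R) : l <= a -> l <= x ->
  \int[mu]_(t in `[l, x]) p (t - a) = p (x - a) ^+ 2 / 2.
Proof.
move=> la lx; rewrite Rintegral_cc_oo; last first.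
  exact: integrable_measurable_fun (pospart_integrable l x a).
have z (y : R) : y <= a -> \int[mu]_(t in `]l, y[) p (t - a) = 0.
  move=> ya; transitivity (\int[mu]_(t in `]l, y[) (cst 0 t : R)).
    apply: eq_Rintegral => t; rewrite inE/= in_itv/= => /andP[t1 t2].
    by rewrite pospart_le0//; lra.
  by rewrite /Rintegral integral0.
have [xa|ax] := leP x a.
  by rewrite z// pospart_le0 ?subr_le0// expr0n mul0r.
rewrite (Rintegral_chasles la (ltW ax) (pospart_integrable l x a)).
rewrite (z _ (lexx a)) add0r (@pospart_ge0 (x - a)); last by rewrite subr_ge0 ltW.
rewrite -(Rintegral_ramp (ltW ax)).
apply: eq_Rintegral => t; rewrite inE/= in_itv/= => /andP[t1 t2].
by rewrite pospart_ge0// subr_ge0 ltW.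
Qed.

Lemma Rintegral_indic_itv (l x a e : R) : l <= a -> l <= x -> 0 < e ->
  \int[mu]_(t in `[l, x]) \1_(`[a, a + e]) t = p (x - a) - p (x - (a + e)).
Proof.
move=> la lx e0; rewrite /Rintegral integral_indic//.
have [xae|aex] := leP x (a + e).
  have -> : `[a, a + e] `&` `[l, x] = `[a, x]%classic.
    by apply/seteqP; split => t /=; rewrite !in_itv/=; lra.
  rewrite (@pospart_le0 (x - (a + e))); last lra.
  rewrite subr0 /= lebesgue_measure_itv/= lte_fin; case: ltP => h.
    by rewrite pospart_ge0 ?subr_ge0 ?ltW.
  by rewrite pospart_le0 ?subr_le0.
have -> : `[a, a + e] `&` `[l, x] = `[a, a + e]%classic.
  by apply/seteqP; split => t /=; rewrite !in_itv/=; lra.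
rewrite /= lebesgue_measure_itv/= lte_fin ltrDl e0 -EFinB/=.
by rewrite !pospart_ge0; lra.
Qed.

(* antiderivative, vanishing for y <= 0, of the truncation of y to [0, e] *)
Definition tentq e y : R := (p y ^+ 2 - p (y - e) ^+ 2) / 2.
Local Notation q := tentq.

Lemma Rintegral_plateau (l x a e : R) : l <= a -> l <= x -> 0 < e ->
  \int[mu]_(t in `[l, x]) (p (t - a) - p (t - (a + e))) = q e (x - a).
Proof.
move=> la lx e0.
rewrite RintegralB//; last 2 first.
  exact/integrable_cc_oo/pospart_integrable.
  exact/integrable_cc_oo/pospart_integrable.
rewrite !Rintegral_pospart//; last lra.
by rewrite /q -mulrBl opprD addrA.
Qed.

(** Tangent inequality for the convex function [tentq e], whose derivative at [z] is the truncation
    [p z - p (z - e)]. The cases are the positions of [y] and [z] relative to 0 and [e]; what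
    remains in each is a square or a product of nonnegative factors. *)
Lemma tentq_tangent e y z : 0 < e -> q e z + (p z - p (z - e)) * (y - z) <= q e y.
Proof.
move=> e0; rewrite -subr_ge0 /q.
have [z0|z0] := leP z 0.
  rewrite (pospart_le0 z0) (@pospart_le0 (z - e)); last lra.
  have [y0|y0] := leP y 0.
    rewrite (pospart_le0 y0) (@pospart_le0 (y - e)); lra.
  rewrite (pospart_ge0 (ltW y0)); have [y1|y1] := leP y e.
    rewrite (@pospart_le0 (y - e)); last lra.
    by have := sqr_ge0 y; lra.
  rewrite (@pospart_ge0 (y - e)); last lra.
  have : 0 <= e * (y - e) by apply: mulr_ge0; lra.
  have : 0 <= e * e by apply: mulr_ge0; lra.
  lra.
rewrite (pospart_ge0 (ltW z0)); have [z1|z1] := leP z e.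
  rewrite (@pospart_le0 (z - e)); last lra.
  have [y0|y0] := leP y 0.
    rewrite (pospart_le0 y0) (@pospart_le0 (y - e)); last lra.
    have : 0 <= z * - y by apply: mulr_ge0; lra.
    have := sqr_ge0 z; lra.
  rewrite (pospart_ge0 (ltW y0)); have [y1|y1] := leP y e.
    rewrite (@pospart_le0 (y - e)); last lra.
    by have := sqr_ge0 (y - z); lra.
  rewrite (@pospart_ge0 (y - e)); last lra.
  have : 0 <= (e - z) * (2 * y - e - z) by apply: mulr_ge0; lra.
  lra.
rewrite (@pospart_ge0 (z - e)); last lra.
have [y0|y0] := leP y 0.
  rewrite (pospart_le0 y0) (@pospart_le0 (y - e)); last lra.
  have : 0 <= e * - y by apply: mulr_ge0; lra.
  have := sqr_ge0 e; lra.
rewrite (pospart_ge0 (ltW y0)); have [y1|y1] := leP y e.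
  rewrite (@pospart_le0 (y - e)); last lra.
  by have := sqr_ge0 (y - e); lra.
rewrite (@pospart_ge0 (y - e)); last lra.
lra.
Qed.

(** [x - b] is the convex combination of [x - a] and [x - c] with weights proportional to [c - b]
    and [b - a]; in the weighted sum of the two tangent inequalities at [x - b] the slopes
    cancel. *)
Lemma tentq_convex a b c e x : 0 < e -> a < b -> b < c ->
  0 <= (c - b) * q e (x - a) - (c - a) * q e (x - b) + (b - a) * q e (x - c).
Proof.
move=> e0 ab bc.
have h1 := @tentq_tangent e (x - a) (x - b) e0.
have h2 := @tentq_tangent e (x - c) (x - b) e0.
move: (q e (x - a)) (q e (x - b)) (q e (x - c)) (p _ - p _) h1 h2 => qa qb qc s h1 h2.
have : 0 <= (c - b) * (qa - (qb + s * (x - a - (x - b)))) by apply: mulr_ge0; lra.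
have : 0 <= (b - a) * (qc - (qb + s * (x - c - (x - b)))) by apply: mulr_ge0; lra.
lra.
Qed.

Lemma Rintegral_lin3 (i : interval R) (c1 c2 c3 : R) (k1 k2 k3 : R -> R) :
  mu.-integrable [set` i] (EFin \o k1) -> mu.-integrable [set` i] (EFin \o k2) ->
  mu.-integrable [set` i] (EFin \o k3) ->
  \int[mu]_(t in [set` i]) (c1 * k1 t - c2 * k2 t + c3 * k3 t) =
  c1 * \int[mu]_(t in [set` i]) k1 t - c2 * \int[mu]_(t in [set` i]) k2 t +
  c3 * \int[mu]_(t in [set` i]) k3 t.
Proof.
move=> i1 i2 i3.
have j1 : mu.-integrable [set` i] (EFin \o (fun t => c1 * k1 t)).
  exact: integrableZ_fin.
have j2 : mu.-integrable [set` i] (EFin \o (fun t => c2 * k2 t)).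
  exact: integrableZ_fin.
have j3 : mu.-integrable [set` i] (EFin \o (fun t => c3 * k3 t)).
  exact: integrableZ_fin.
have j : mu.-integrable [set` i] (EFin \o (fun t => c1 * k1 t - c2 * k2 t)).
  exact: integrableB_fin.
by rewrite RintegralD// RintegralB// !RintegralZl.
Qed.

(* e times the average over a shift of size e of Dirac masses at a, b, c, weighted as in
   the concavity inequality; the associated psi is nonnegative by convexity of tentq e *)
Definition tent a b c e : R -> R := fun x =>
  (c - b) * \1_(`[a, a + e]) x - (c - a) * \1_(`[b, b + e]) x + (b - a) * \1_(`[c, c + e]) x.

Lemma tent_test (r a b c e : R) : - r < a -> a < b -> b < c -> 0 < e -> c + e < r ->
  exists psi dpsi, W2inf_W1inf0 r psi dpsi (tent a b c e) /\
    forall x : R, x \in `]- r, r[ -> 0 <= psi x.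
Proof.
move=> ra ab bc e0 cr.
pose P (a x : R) := p (x - a) - p (x - (a + e)).
have iI (l x d : R) : mu.-integrable `[l, x] (EFin \o \1_(`[d, d + e])).
  apply/integrable_cc_oo/(@integrable_ae_bounded _ _ _ _ 1); first exact: measurable_indic.
  by apply: aeW => t _; rewrite indicE; case: (t \in _); rewrite ?normr1 ?normr0.
have iP (l x d : R) : mu.-integrable `[l, x] (EFin \o P d).
  apply/integrable_cc_oo; apply: integrableB_fin => //; exact: pospart_integrable.
(* Slope 0 at [- r]: the tent is supported to the right of [a], so [psi] vanishes up to [a]. *)
pose K (x : R) := 0 + \int[mu]_(t in `[- r, x]) tent a b c e t.
have KE x : - r <= x -> K x = (c - b) * P a x - (c - a) * P b x + (b - a) * P c x.
  move=> rx; rewrite /K add0r /tent Rintegral_lin3// !Rintegral_indic_itv//; lra.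
have psiE x : - r <= x -> \int[mu]_(t in `[- r, x]) K t =
    (c - b) * q e (x - a) - (c - a) * q e (x - b) + (b - a) * q e (x - c).
  move=> rx.
  have -> : \int[mu]_(t in `[- r, x]) K t =
      \int[mu]_(t in `[- r, x]) ((c - b) * P a t - (c - a) * P b t + (b - a) * P c t).
    by apply: eq_Rintegral => t; rewrite inE/= in_itv/= => /andP[t1 t2]; exact: KE.
  by rewrite Rintegral_lin3// !Rintegral_plateau//; lra.
exists (fun x => \int[mu]_(t in `[- r, x]) K t), K; split; last first.
  move=> x; rewrite in_itv/= => /andP[h1 h2]; rewrite (psiE _ (ltW h1)).
  exact: tentq_convex.
apply: (@W2inf_of_second_derivative _ _ _ (`|c - b| + `|c - a| + `|b - a|)); first lra.
- apply: measurable_funD; first apply: measurable_funB.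
  + by apply: measurable_funM => //; exact: measurable_indic.
  + by apply: measurable_funM => //; exact: measurable_indic.
  + by apply: measurable_funM => //; exact: measurable_indic.
- move=> x; rewrite /tent !indicE.
  have B (d : R) (s : bool) : `|d * s%:R| <= `|d|.
    by case: s; rewrite ?mulr1// mulr0 normr0.
  apply: le_trans (ler_normD _ _) _; apply: lerD => //.
  by apply: le_trans (ler_normB _ _) _; apply: lerD.
(* For [y >= e], [tentq e y] is affine in [y]. As [c + e < r], all three arguments at [r] are in
   this range, and the weights annihilate affine functions; hence [psi r = 0]. *)
- rewrite -/K psiE; last lra.
  rewrite /q !pospart_ge0; try lra.
Qed.

End tent.

(** * Concavity at Lebesgue points *)

Section lebesgue_points.
Context {R : realType}.
Notation mu := (@lebesgue_measure R).

Variable r : R.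
Hypothesis r0 : 0 < r.
Variable g : R -> R.
Hypothesis gi : mu.-integrable `]- r, r[ (EFin \o g).
Hypothesis H : forall psi dpsi d2psi : R -> R, W2inf_W1inf0 r psi dpsi d2psi ->
  (forall x : R, x \in `]- r, r[ -> 0 <= psi x) ->
  \int[mu]_(x in `]- r, r[) (g x * d2psi x) <= 0.

Let g0 : R -> R := g \_ `]- r, r[.
(** Antiderivative of the extension of [g] by zero: at almost every point [G] has derivative [g0],
    and the integrals of [g] against indicators are increments of [G]. *)
Let G (x : R) := \int[mu]_(t in `]-oo, x]) g0 t.

Let g0i (y : R) : mu.-integrable `]-oo, y] (EFin \o g0).
Proof.
apply: (@integrableS _ _ _ _ setT) => //.
rewrite /g0 -restrict_EFin.
by case: (integrable_mkcond (mu := mu) (EFin \o g) (measurable_itv `]- r, r[)) => + _; apply.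
Qed.

Let G_ae : {ae mu, forall x, derivable G x 1 /\ derive1 G x = g0 x}.
Proof. by apply: (FTC1Ny g0i); exact: integrable_locally. Qed.

Let G_diff (x e : R) : - r < x -> 0 < e -> x + e < r ->
  \int[mu]_(t in `]- r, r[) (g t * \1_(`[x, x + e]) t) = G (x + e) - G x.
Proof.
move=> rx e0 xr.
have -> : G (x + e) - G x = \int[mu]_(t in `]x, x + e]) g0 t.
  by apply: Rintegral_itvB; rewrite ?bnd_simp//; lra.
have gxe : mu.-integrable `]x, x + e] (EFin \o g).
  apply: integrableS gi => // t /=; rewrite !in_itv/=; lra.
transitivity (\int[mu]_(t in `]x, x + e]) g t); last first.
  apply: eq_Rintegral => t; rewrite inE/= in_itv/= => /andP[t1 t2].
  by rewrite /g0 patchE mem_set//= in_itv/=; lra.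
rewrite (Rintegral_itv_obnd_cbnd gxe).
have -> : `[x, x + e]%classic = `]- r, r[ `&` `[x, x + e]%classic.
  by apply/seteqP; split => t /=; rewrite !in_itv/=; lra.
rewrite Rintegral_mkcondr; apply: eq_Rintegral => t; rewrite inE => tr.
rewrite patchE indicE; case: ifPn => h.
  by rewrite mem_set ?mulr1//; split => //; exact: set_mem.
rewrite memNset ?mulr0// => -[_ ht]; move: h; rewrite notin_setE; exact.
Qed.

(** Only the right-hand limit is kept, because the averaging intervals [[x, x + h]] lie to the right
    of the point. *)
Let G_cvg (x : R) : derivable G x 1 -> derive1 G x = g x ->
  (fun h => h^-1 * (G (x + h) - G x)) @ 0^'+ --> g x.
Proof.
move=> dG gx; apply: cvg_dnbhs_at_right.
rewrite -gx derive1E.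
have := dG; rewrite /derivable => /cvgP; rewrite -/(derive G x 1).
rewrite (_ : (fun h => h^-1 *: ((G \o shift x) (h *: 1) - G x)) =
  (fun h => h^-1 * (G (x + h) - G x)))//.
by apply/funext => h /=; rewrite /GRing.scale/= mulr1 (addrC h).
Qed.

Lemma superharmonic_concave : exists S : set R,
  [/\ forall x, S x -> - r < x < r, forall x, S x -> 0 <= g x, concave_on S g &
      {ae mu, forall x : R, x \in `]- r, r[ -> S x}].
Proof.
(* The good points: interior points where [g] is nonnegative and is the derivative of its own
   primitive. *)
exists [set x | - r < x < r /\ (0 <= g x /\ (derivable G x 1 /\ derive1 G x = g x))]; split.
- by move=> x [].
- by move=> x [_ []].
- move=> a b c [/andP[a1 a2] [_ [da ga]]] [_ [_ [db gb]]] [/andP[c1 c2] [_ [dc gc]]] ab bc.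
  have ca := G_cvg da ga; have cb := G_cvg db gb; have cc := G_cvg dc gc.
  rewrite -subr_ge0.
  (* The test with [tent a b c e], divided by [e], is the concavity inequality for difference
     quotients of [G]; it passes to the limit as [e] tends to 0 from the right. *)
  have : (fun h => (c - a) * (h^-1 * (G (b + h) - G b)) -
      ((c - b) * (h^-1 * (G (a + h) - G a)) + (b - a) * (h^-1 * (G (c + h) - G c)))) @ 0^'+ -->
      (c - a) * g b - ((c - b) * g a + (b - a) * g c).
    apply: cvgB; first exact: cvgMr.
    by apply: cvgD; exact: cvgMr.
  move=> /cvgr_to_ge; apply.
  near=> e.
  have e0 : 0 < e by near: e; exact: nbhs_right_gt.
  have er : c + e < r.
    by rewrite -ltrBrDl; near: e; apply: nbhs_right_lt; rewrite subr_gt0.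
  have [psi [dpsi [W psi0]]] := @tent_test _ r a b c e a1 ab bc e0 er.
  have := H W psi0.
  have E (d : R) : measurable (`[d, d + e]%classic : set R) by [].
  have -> : \int[mu]_(x in `]- r, r[) (g x * tent a b c e x) =
     (c - b) * (G (a + e) - G a) - (c - a) * (G (b + e) - G b) + (b - a) * (G (c + e) - G c).
    have rb := lt_trans a1 ab; have rc := lt_trans rb bc.
    have ber : b + e < r by rewrite (lt_trans _ er)// ltrD2r.
    have aer : a + e < r by rewrite (lt_trans _ ber)// ltrD2r.
    rewrite -(G_diff a1 e0 aer) -(G_diff rb e0 ber) -(G_diff rc e0 er).
    rewrite -Rintegral_lin3; try exact: integrable_mul_indic.
    by apply: eq_Rintegral => x _; rewrite /tent; ring.
  move: (G (a + e) - G a) (G (b + e) - G b) (G (c + e) - G c) => A B C h.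
  have -> : (c - a) * (e^-1 * B) - ((c - b) * (e^-1 * A) + (b - a) * (e^-1 * C)) =
    e^-1 * ((c - a) * B - ((c - b) * A + (b - a) * C)) by ring.
  by apply: mulr_ge0; [rewrite invr_ge0 ltW|rewrite subr_ge0 -subr_le0 addrAC].
- have := aeI G_ae (superharmonic_ge0 r0 gi H).
  apply: aeS => x /= [[dG gx] gx0] xr.
  have xr' : - r < x < r by move: xr; rewrite in_itv.
  split => //; split; first exact: gx0.
  by split => //; rewrite gx /g0 patchE mem_set.
Unshelve. all: by end_near. Qed.

End lebesgue_points.

(** * Sign of the potential *)

Section sign_change.
Context {R : realType}.
Notation mu := (@lebesgue_measure R).
Variables (rad r0 : R) (f : R -> R).
Hypotheses (rad0 : 0 < rad) (mf : measurable_fun `]- rad, rad[ f).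
Hypothesis ev : forall x : R, x \in `]- rad, rad[ -> f (- x) = f x.
Hypothesis fint : (\int[mu]_(s in `]0%R, rad[) (`|f s| * (rad - s))%:E < +oo)%E.
Hypotheses (r00 : 0 < r0) (r0rad : r0 < rad).
Hypothesis fp : {ae mu, forall r : R, r \in `]0, r0[ -> 0 <= f r}.
Hypothesis fn : {ae mu, forall r : R, r \in `]r0, rad[ -> f r <= 0}.

Local Notation F := (primitive f).
Local Notation w := (potential rad f).

Let mf0 : measurable_fun `]0, rad[ f.
Proof. by have rp := rad0; apply: measurable_sub_oo mf; lra. Qed.

Lemma measurable_fpos (a b : R) : measurable_fun `]a, b[ f -> measurable_fun `]a, b[ (fpos f).
Proof. by move=> m; apply: measurable_maxr => //; exact: measurable_cst. Qed.

Lemma measurable_fneg (a b : R) : measurable_fun `]a, b[ f -> measurable_fun `]a, b[ (fneg f).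
Proof.
move=> m; apply: measurableT_comp => //.
by apply: measurable_minr => //; exact: measurable_cst.
Qed.

Lemma fposE x : 0 <= f x -> fpos f x = f x.
Proof. by move=> h; rewrite /fpos max_l. Qed.

Lemma fnegE x : f x <= 0 -> fneg f x = - f x.
Proof. by move=> h; rewrite /fneg min_l. Qed.

Lemma fneg_ge0 x : 0 <= fneg f x.
Proof. by rewrite /fneg oppr_ge0 ge_min lexx orbT. Qed.

Let fi (t : R) : t < rad -> mu.-integrable `]0, t[ (EFin \o f).
Proof. by move=> tr; exact: integrable_weight tr mf0 fint. Qed.

Let P := \int[mu]_(s in `]0, r0[) fpos f s.
Let N (t : R) := \int[mu]_(s in `]r0, t[) fneg f s.

Let ae_fpos : {ae mu, forall x : R, x \in `]0, r0[ -> f x = fpos f x}.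
Proof. by apply: aeS fp => x h xr; rewrite fposE// h. Qed.

Let ae_fneg (t : R) : t <= rad ->
  {ae mu, forall x : R, x \in `]r0, t[ -> f x = - fneg f x}.
Proof.
move=> tr; apply: aeS fn => x h; rewrite in_itv/= => /andP[x1 x2].
by rewrite fnegE ?opprK// h// in_itv/= x1 (lt_le_trans x2).
Qed.

Let mpos : measurable_fun `]0, r0[ (fpos f).
Proof. by apply: measurable_fpos; apply: measurable_sub_oo mf0 => //; exact: ltW. Qed.

Let mneg (t : R) : t <= rad -> measurable_fun `]r0, t[ (fneg f).
Proof. by move=> tr; apply: measurable_fneg; apply: measurable_sub_oo mf0 => //; exact: ltW. Qed.

Lemma fpos_integrable : mu.-integrable `]0, r0[ (EFin \o fpos f).
Proof.
apply: le_integrable (fi r0rad) => //; first exact/measurable_EFinP.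
move=> x _ /=; rewrite lee_fin /fpos; case: (leP (f x) 0) => h.
  by rewrite normr0.
by [].
Qed.

Lemma fneg_integrable (t : R) : r0 <= t -> mu.-integrable `]0, t[ (EFin \o f) -> t <= rad ->
  mu.-integrable `]r0, t[ (EFin \o fneg f).
Proof.
move=> rt fit tr.
have i : mu.-integrable `]r0, t[ (EFin \o f) by apply: integrable_sub_oo fit => //; exact: ltW.
apply: le_integrable i => //; first by apply/measurable_EFinP; exact: mneg.
move=> x _ /=; rewrite lee_fin /fneg normrN; case: (leP (f x) 0) => h.
  by [].
by rewrite normr0.
Qed.

(** Integrability up to [t] is a hypothesis so that [t = rad] is included; this endpoint value
    decides flatness. *)
Lemma primitive_fpos_fneg (t : R) : r0 <= t -> t <= rad -> mu.-integrable `]0, t[ (EFin \o f) ->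
  F t = P - N t.
Proof.
move=> rt tr fit.
rewrite primitive_pos; last by apply: le_trans rt; exact: ltW.
rewrite (Rintegral_chasles (ltW r00) rt fit); congr (_ + _).
  apply: Rintegral_ae_eq => //.
  by apply: measurable_sub_oo mf0 => //; exact: ltW.
rewrite /N -RintegralN//; last exact: fneg_integrable.
apply: Rintegral_ae_eq => //.
- by apply: measurable_sub_oo mf0 => //; exact: ltW.
- by apply: measurableT_comp => //; exact: mneg.
- exact: ae_fneg.
Qed.

Lemma integral_fpos : (\int[mu]_(s in `]0%R, r0[) (fpos f s)%:E = P%:E)%E.
Proof.
by rewrite fineK//; apply: integrable_fin_num => //; exact: fpos_integrable.
Qed.

Lemma integral_fneg (t : R) : r0 <= t -> mu.-integrable `]0, t[ (EFin \o f) -> t <= rad ->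
  (\int[mu]_(s in `]r0, t[) (fneg f s)%:E = (N t)%:E)%E.
Proof.
by move=> rt fit tr; rewrite fineK//; apply: integrable_fin_num => //; exact: fneg_integrable.
Qed.

Let iF : mu.-integrable `]- rad, rad[ (EFin \o F).
Proof. exact: primitive_integrable. Qed.

(** [N] may be unbounded near [rad]; its integrability is read off from [N = P - F]. *)
Let iN (x : R) : r0 < x -> x < rad -> mu.-integrable `]x, rad[ (EFin \o N).
Proof.
move=> rx xr.
have : mu.-integrable `]x, rad[ (EFin \o (fun t => P - F t)).
  apply: integrableB_fin => //; first exact: (integrable_cst_oo x rad P).
  have rp := rad0; have r0p := r00; apply: integrable_sub_oo iF => //; lra.
apply: eq_integrable => // t; rewrite inE/= in_itv/= => /andP[t1 t2].
rewrite primitive_fpos_fneg ?opprB ?subrKC//; [|exact: ltW|exact: fi].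
exact: ltW (lt_trans rx t1).
Qed.

Let potential_fneg (x : R) : r0 < x -> x < rad ->
  w x = (rad - x) * P - \int[mu]_(t in `]x, rad[) N t.
Proof.
move=> rx xr; rewrite /potential.
have -> : \int[mu]_(t in `]x, rad[) F t = \int[mu]_(t in `]x, rad[) (P - N t).
  apply: eq_Rintegral => t; rewrite inE/= in_itv/= => /andP[t1 t2].
  by rewrite primitive_fpos_fneg//; [exact: ltW (lt_trans rx t1)|exact: ltW|exact: fi].
have -> : \int[mu]_(t in `]x, rad[) (P - N t) =
    \int[mu]_(t in `]x, rad[) P - \int[mu]_(t in `]x, rad[) N t.
  by apply: RintegralB => //; [exact: (integrable_cst_oo x rad P)|exact: iN].
by rewrite (Rintegral_cst_oo P (ltW xr)) mulrC.
Qed.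

Lemma decayP : decay rad r0 f <-> (forall x : R, x \in `]r0, rad[ -> 0 < w x).
Proof.
have key (x : R) : r0 < x -> x < rad ->
    (\int[mu]_(t in `]x, rad[) (\int[mu]_(s in `]r0, t[) (fneg f s)%:E) <
    (* Every integral in the decay condition is finite, so the extended inequality at [x] is a real
       one, and its difference of sides is [w x]. *)
    (rad - x)%:E * \int[mu]_(s in `]0%R, r0[) (fpos f s)%:E)%E = (0 < w x).
  move=> rx xr.
  have -> : (\int[mu]_(t in `]x, rad[) (\int[mu]_(s in `]r0, t[) (fneg f s)%:E) =
      \int[mu]_(t in `]x, rad[) (N t)%:E)%E.
    apply: eq_integral => t; rewrite inE/= in_itv/= => /andP[t1 t2].
    by rewrite integral_fneg//; [exact: ltW (lt_trans rx t1)|exact: fi|exact: ltW].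
  have -> : (\int[mu]_(t in `]x, rad[) (N t)%:E = (\int[mu]_(t in `]x, rad[) N t)%R%:E)%E.
    by rewrite fineK//; apply: integrable_fin_num => //; exact: iN.
  by rewrite integral_fpos -EFinM lte_fin potential_fneg// subr_gt0.
split=> h x xr; have := h x xr; have := xr; rewrite in_itv/= => /andP[x1 x2].
  by rewrite key.
by rewrite key.
Qed.

Hypothesis dec : decay rad r0 f.

Lemma primitive_ge0 (t : R) : 0 <= t -> t < rad -> 0 <= F t.
Proof.
move=> t0 tr; have [trr|rt] := leP t r0.
  rewrite primitive_pos//.
  rewrite (Rintegral_ae_eq (g := fpos f))//.
  - by apply: Rintegral_ge0 => x _; rewrite /fpos le_max lexx orbT.
  - by apply: measurable_sub_oo mf0 => //; exact: ltW.
  - by apply: measurable_sub_oo mpos.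
  - apply: aeS ae_fpos => x h /=; rewrite in_itv/= => /andP[x1 x2].
    by apply: h; rewrite in_itv/= x1 (lt_le_trans x2).
(* Beyond [r0] the primitive does not increase, so a negative value at [t] persists up to [rad] and
   gives [w t <= 0], against the decay condition. *)
rewrite leNgt; apply/negP => Ft.
have wt : 0 < w t by apply: (decayP.1 dec); rewrite in_itv/= rt.
have : w t <= 0.
  rewrite /potential -oppr_ge0 -RintegralN//; last first.
    by have rp := rad0; apply: integrable_sub_oo iF; lra.
  apply: Rintegral_ge0 => s /=; rewrite in_itv/= => /andP[ts sr].
  rewrite oppr_ge0 (le_trans _ (ltW Ft))//.
  have rs := lt_trans rt ts.
  rewrite (primitive_fpos_fneg (ltW rs) (ltW sr) (fi sr)).
  rewrite (primitive_fpos_fneg (ltW rt) (ltW tr) (fi tr)).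
  rewrite lerD2l lerN2; apply: le_Rintegral_itv => //; [exact: ltW|exact: ltW| |].
    by apply: fneg_integrable; [exact: ltW|exact: fi|exact: ltW].
  by move=> x _; exact: fneg_ge0.
by rewrite leNgt wt.
Qed.

Lemma potential_nonincreasing (x y : R) : 0 <= x -> x <= y -> y < rad -> w y <= w x.
Proof.
move=> x0 xy yr; rewrite /potential.
rewrite (Rintegral_chasles xy (ltW yr)); last first.
  by have rp := rad0; apply: integrable_sub_oo iF; lra.
rewrite lerDr; apply: Rintegral_ge0 => t /=; rewrite in_itv/= => /andP[t1 t2].
by apply: primitive_ge0; lra.
Qed.

Lemma potential_gt0 (x : R) : - rad < x -> x < rad -> 0 < w x.
Proof.
wlog x0 : x / 0 <= x => [hw|] x1 x2.
  have [/hw->//|x0] := leP 0 x.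
  by rewrite -(potential_even rad0 mf ev fint) ?hw//; lra.
have r0p := r00; have r0r := r0rad.
have [xr|rx] := leP x r0; last by apply: (decayP.1 dec); rewrite in_itv/= rx.
(* The decay condition speaks only of points beyond [r0]; the midpoint of [r0] and [rad] is one of
   them, and [w] is at least as large to its left. *)
have : w ((r0 + rad) / 2) <= w x by apply: potential_nonincreasing; lra.
by apply: lt_le_trans; apply: (decayP.1 dec); rewrite in_itv/=; lra.
Qed.

End sign_change.

(** * From almost everywhere to every point and to the endpoints *)

Section closures.
Context {R : realType}.
Notation mu := (@lebesgue_measure R).

Lemma continuous_ae_eq (a b : R) (v w : R -> R) :
  {in `]a, b[, continuous v} -> {in `]a, b[, continuous w} ->
  {ae mu, forall x : R, x \in `]a, b[ -> v x = w x} ->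
  forall x : R, x \in `]a, b[ -> v x = w x.
Proof.
move=> cv cw e x xab; apply/eqP; apply: contrapT => /negP vw.
have c : (fun y => v y - w y) y @[y --> x] --> v x - w x.
  by apply: cvgB; [exact: cv|exact: cw].
have vw0 : v x - w x != 0 by rewrite subr_eq0.
have : \forall y \near x, v y - w y != 0.
  exact: (cvgr_neq0 _ c vw0).
move=> /nbhs_ballP[d /= d0 hd].
have := xab; rewrite in_itv/= => /andP[ax xb].
have [||y] := @ae_pick _ (fun y => v y = w y) x (Num.min b (x + d)).
- by rewrite lt_min xb ltrDl.
- apply: aeS e => y h; rewrite in_itv/= lt_min => /and3P[xy yb _].
  by apply: h; rewrite in_itv/= yb (lt_trans ax).
rewrite in_itv/= lt_min => /and3P[xy yb yd] vwy.
have /hd : ball x d y by rewrite /ball/= ltr_norml; lra.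
by rewrite vwy subrr eqxx.
Qed.

(** Endpoint values are one-sided limits of interior values. Applied to the derivatives [dv], which
    are identified only inside the interval. *)
Lemma continuous_closed_eq (a b : R) (v w : R -> R) : a < b ->
  {within `[a, b], continuous v} -> {within `[a, b], continuous w} ->
  (forall x : R, x \in `]a, b[ -> v x = w x) -> v a = w a /\ v b = w b.
Proof.
move=> ab /(continuous_within_itvP _ ab)[_ va vb] /(continuous_within_itvP _ ab)[_ wa wb] e.
split.
- suff vw : v x @[x --> a^'+] --> w a by exact: (cvg_unique (@Rhausdorff R) va vw).
  apply: cvg_trans wa; apply: near_eq_cvg.
  near=> x; rewrite e// in_itv/=; apply/andP; split; near: x.
    exact: nbhs_right_gt.
  exact: nbhs_right_lt.
- suff vw : v x @[x --> b^'-] --> w b by exact: (cvg_unique (@Rhausdorff R) vb vw).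
  apply: cvg_trans wb; apply: near_eq_cvg.
  near=> x; rewrite e// in_itv/=; apply/andP; split; near: x.
    exact: nbhs_left_gt.
  exact: nbhs_left_lt.
Unshelve. all: by end_near. Qed.

Lemma ae_oppr (Q : R -> Prop) : {ae mu, forall x, Q x} -> {ae mu, forall x, Q (- x)}.
Proof.
move=> [A [mA A0 QA]]; exists (-%R @^-1` A); split.
- by rewrite -[X in measurable X]setTI; exact: (oppr_measurable measurableT).
- by have := lebesgue_measureN mA; rewrite A0.
- by move=> x /= nQ; exact: QA.
Qed.

End closures.

(** * Supersolutions *)

Section one_sided_derivatives.
Context {R : realType}.
Notation mu := (@lebesgue_measure R).
Variables (rad : R) (u v dv : R -> R) (Q : R -> Prop).
Hypotheses (rad0 : 0 < rad) (C : C1_rep rad u v dv).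
Hypothesis aeQ : {ae mu, forall x : R, x \in `]- rad, rad[ -> Q x}.

Let mvt (a b : R) : - rad <= a -> a < b -> b <= rad ->
  exists2 c, a < c < b & v b - v a = dv c * (b - a).
Proof.
move=> ra ab br; case: C => _ cv _ d.
have d' (x : R) : x \in `]a, b[ -> is_derive x (1 : R) v (dv x).
  by rewrite in_itv/= => /andP[x1 x2]; apply: d; rewrite in_itv/=; lra.
have cv' : {within `[a, b], continuous v}.
  by apply: continuous_subspaceW cv; apply: subset_itv; rewrite bnd_simp.
have [c] := MVT ab d' cv'.
by rewrite in_itv/=; exists c.
Qed.

(** Monotonicity is known only at the good points [Q]; two of them exist in every subinterval since
    their complement is null. *)
Let pick2 (a b : R) : - rad <= a -> a < b -> b <= rad ->
  exists x y, [/\ a < x, x < y, y < b, Q x & Q y].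
Proof.
move=> ra ab br.
have pick (c d : R) : - rad <= c -> c < d -> d <= rad -> exists2 x, c < x < d & Q x.
  move=> rc cd dr; have [|x] := @ae_pick _ Q c d cd.
    by apply: aeS aeQ => x h; rewrite in_itv/= => /andP[x1 x2]; apply: h; rewrite in_itv/=; lra.
  by rewrite in_itv/=; exists x.
have [|||x /andP[x1 x2] Qx] := pick a ((a + b) / 2); try lra.
have [|||y /andP[y1 y2] Qy] := pick ((a + b) / 2) b; try lra.
by exists x, y; split => //; lra.
Qed.

(** If [dv rad > 0], then [dv > 0] near [rad], and the mean value theorem between two good points
    there contradicts [v y <= v x]. *)
Lemma C1_rep_right_le0 : (forall x y : R, 0 < x -> x < y -> y < rad -> Q x -> Q y -> v y <= v x) ->
  dv rad <= 0.
Proof.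
move=> mono; rewrite leNgt; apply/negP => dv0.
have lt : - rad < rad by have rp := rad0; lra.
case: (C) => _ _ /(continuous_within_itvP _ lt)[_ _ c] _.
have : \forall x \near rad, x < rad -> 0 < dv x by exact: (cvgr_gt _ c _ dv0).
move=> /nbhs_ballP[d /= d0 hd].
have [|||x [y [x1 xy y1 Qx Qy]]] := @pick2 (Num.max 0 (rad - d)) rad.
- by rewrite le_max; apply/orP; left; have rp := rad0; lra.
- by rewrite gt_max rad0 ltrBlDr ltrDl.
- by [].
move: x1; rewrite gt_max => /andP[x0 xd].
have := mono _ _ x0 xy y1 Qx Qy; rewrite leNgt => /negP; apply.
have [|||z /andP[z1 z2] e] := @mvt x y; try lra.
rewrite -subr_gt0 e mulr_gt0 ?subr_gt0//.
apply: hd; last lra.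
by rewrite /ball/= ger0_norm; lra.
Qed.

Lemma C1_rep_left_ge0 : (forall x y : R, - rad < x -> x < y -> y < 0 -> Q x -> Q y -> v x <= v y) ->
  0 <= dv (- rad).
Proof.
move=> mono; rewrite leNgt; apply/negP => dv0.
have lt : - rad < rad by have rp := rad0; lra.
case: (C) => _ _ /(continuous_within_itvP _ lt)[_ c _] _.
have : \forall x \near - rad, - rad < x -> dv x < 0 by exact: (cvgr_lt _ c _ dv0).
move=> /nbhs_ballP[d /= d0 hd].
have [|||x [y [x1 xy y1 Qx Qy]]] := @pick2 (- rad) (Num.min 0 (- rad + d)).
- by [].
- by rewrite lt_min ltrDl d0 oppr_lt0 rad0.
- by rewrite ge_min; apply/orP; left; have rp := rad0; lra.
move: y1; rewrite lt_min => /andP[y0 yd].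
have := mono _ _ x1 xy y0 Qx Qy; rewrite leNgt => /negP; apply.
have [|||z /andP[z1 z2] e] := @mvt x y; try lra.
rewrite -subr_lt0 e pmulr_llt0 ?subr_gt0//.
apply: hd; last lra.
by rewrite /ball/= distrC ger0_norm; lra.
Qed.

End one_sided_derivatives.

(** * Comparison of supersolutions and solutions with the potential *)

Section supersolutions.
Context {R : realType}.
Notation mu := (@lebesgue_measure R).
Variables (rad : R) (f : R -> R).
Hypotheses (rad0 : 0 < rad) (mf : measurable_fun `]- rad, rad[ f).
Hypothesis ev : forall x : R, x \in `]- rad, rad[ -> f (- x) = f x.
Hypothesis fint : (\int[mu]_(s in `]0%R, rad[) (`|f s| * (rad - s))%:E < +oo)%E.

Local Notation w := (potential rad f).

Lemma integrable_mul_test (u psi dpsi d2psi : R -> R) :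
  mu.-integrable `]- rad, rad[ (EFin \o u) -> W2inf_W1inf0 rad psi dpsi d2psi ->
  mu.-integrable `]- rad, rad[ (EFin \o (fun x => u x * d2psi x)).
Proof.
move=> ui W; case: (W) => _ [M hM] _ _ _.
have mu' := integrable_measurable_fun ui.
have md := integrable_measurable_fun (test_integrable W).
have m : measurable_fun `]- rad, rad[ (fun x => u x * d2psi x) by exact: measurable_funM.
apply/integrableP; split; first exact/measurable_EFinP.
have iM := integrable_norm (integrableZ_fin `|M| (measurable_itv _) ui).
have /integrableP[m2 lt2] := iM.
apply: le_lt_trans lt2; apply: ae_ge0_le_integral => //.
- by apply/measurable_EFinP; exact: measurableT_comp.
- by apply/measurable_EFinP; apply: measurableT_comp => //; exact/measurable_EFinP.
- apply: aeS hM => x /= h xr; rewrite lee_fin normr_id !normrM normr_id mulrC.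
  by rewrite ler_wpM2r// (le_trans (h xr))// ler_norm.
Qed.

Lemma potential_integrable : mu.-integrable `]- rad, rad[ (EFin \o w).
Proof. by apply: continuous_integrable_oo; exact: potential_continuous_closed. Qed.

(** [weak_potential] trades the integral of [w * d2psi] for that of [f * psi], so that testing
    [u - w] leaves no right-hand side. All integrals are finite, which allows passing to real
    numbers. *)
Let diff_test (u psi dpsi d2psi : R -> R) :
  mu.-integrable `]- rad, rad[ (EFin \o u) -> W2inf_W1inf0 rad psi dpsi d2psi ->
  [/\ (\int[mu]_(x in `](- rad)%R, rad[) (f x * psi x)%:E =
       (\int[mu]_(x in `]- rad, rad[) (f x * psi x))%R%:E)%E,
      (\int[mu]_(x in `](- rad)%R, rad[) (u x * d2psi x)%:E =
       (\int[mu]_(x in `]- rad, rad[) (u x * d2psi x))%R%:E)%E &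
      \int[mu]_(x in `]- rad, rad[) ((u x - w x) * d2psi x) =
      \int[mu]_(x in `]- rad, rad[) (u x * d2psi x) +
      \int[mu]_(x in `]- rad, rad[) (f x * psi x)].
Proof.
move=> ui W.
have iu := integrable_mul_test ui W.
have iw := integrable_mul_test potential_integrable W.
have [i _ e] := weak_potential rad0 W mf ev fint.
split.
- by rewrite fineK//; apply: integrable_fin_num.
- by rewrite fineK//; apply: integrable_fin_num.
rewrite e.
have -> : \int[mu]_(x in `]- rad, rad[) ((u x - w x) * d2psi x) =
  \int[mu]_(x in `]- rad, rad[) (u x * d2psi x - w x * d2psi x).
  by apply: eq_Rintegral => x _; rewrite mulrBl.
exact: RintegralB.
Qed.

Lemma supersolution_test (u psi dpsi d2psi : R -> R) : vw_supersolution rad f u ->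
  W2inf_W1inf0 rad psi dpsi d2psi -> (forall x : R, x \in `]- rad, rad[ -> 0 <= psi x) ->
  \int[mu]_(x in `]- rad, rad[) ((u x - w x) * d2psi x) <= 0.
Proof.
move=> [ui h] W psi0; have [e1 e2 ->] := diff_test ui W.
by have := h _ _ _ W psi0; rewrite e1 e2 -EFinN lee_fin -subr_ge0 -oppr_le0 opprB opprK addrC.
Qed.

Lemma solution_test (u psi dpsi d2psi : R -> R) : vw_solution rad f u ->
  W2inf_W1inf0 rad psi dpsi d2psi ->
  \int[mu]_(x in `]- rad, rad[) ((u x - w x) * d2psi x) = 0.
Proof.
move=> [ui h] W; have [e1 e2 ->] := diff_test ui W.
by have := h _ _ _ W; rewrite e1 e2 -EFinN => -[<-]; rewrite subrr.
Qed.

(** For a solution the test of [u - w] gives 0, so [superharmonic_ge0] applies to [u - w] and to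
    [w - u]. *)
Lemma solution_ae (u : R -> R) : vw_solution rad f u ->
  {ae mu, forall x : R, x \in `]- rad, rad[ -> u x = w x}.
Proof.
move=> su; have ui := su.1.
have i1 : mu.-integrable `]- rad, rad[ (EFin \o (fun x => u x - w x)).
  by apply: integrableB_fin => //; exact: potential_integrable.
have i2 : mu.-integrable `]- rad, rad[ (EFin \o (fun x => w x - u x)).
  by apply: integrableB_fin => //; exact: potential_integrable.
have a1 : {ae mu, forall x : R, x \in `]- rad, rad[ -> 0 <= u x - w x}.
  by apply: (superharmonic_ge0 rad0 i1) => psi dpsi d2psi W _; rewrite (solution_test su W).
have a2 : {ae mu, forall x : R, x \in `]- rad, rad[ -> 0 <= w x - u x}.
  apply: (superharmonic_ge0 rad0 i2) => psi dpsi d2psi W _.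
  have -> : \int[mu]_(x in `]- rad, rad[) ((w x - u x) * d2psi x) =
      - \int[mu]_(x in `]- rad, rad[) ((u x - w x) * d2psi x).
    rewrite -RintegralN//; last exact: (integrable_mul_test i1 W).
    by apply: eq_Rintegral => x _; rewrite -mulNr opprB.
  by rewrite (solution_test su W) oppr0.
apply: aeS (aeI a1 a2) => x [h1 h2] xr.
by have := h1 xr; have := h2 xr; rewrite !subr_ge0 => k1 k2; apply/eqP; rewrite eq_le k1 k2.
Qed.

Lemma supersolution_structure (u : R -> R) : vw_supersolution rad f u ->
  let g x := u x - w x in
  exists S : set R,
  [/\ forall x, S x -> - rad < x < rad, forall x, S x -> 0 <= g x, concave_on S g &
      {ae mu, forall x : R, x \in `]- rad, rad[ -> S x}].
Proof.
move=> su g; apply: superharmonic_concave => //.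
  by apply: integrableB_fin => //; [case: su|exact: potential_integrable].
by move=> psi dpsi d2psi W psi0; exact: (supersolution_test su W psi0).
Qed.

Lemma potential_continuous : {in `]- rad, rad[, continuous w}.
Proof.
have lt : - rad < rad by have rp := rad0; lra.
by have /(continuous_within_itvP _ lt)[] := potential_continuous_closed rad0 mf ev fint.
Qed.

Lemma supersolution_pos_in (u : R -> R) :
  (forall x : R, - rad < x -> x < rad -> 0 < w x) ->
  vw_supersolution rad f u -> pos_in rad u.
Proof.
move=> w0 su; have [S [Sr Sg cS aeS']] := supersolution_structure su.
have [|h [hS h0 ch]] := concave_extension rad0 _ Sg cS Sr.
  move=> x y rx xy yr; have [|s] := @ae_pick _ S x y xy.
    by apply: aeS aeS' => t k; rewrite in_itv/= => /andP[t1 t2]; apply: k; rewrite in_itv/=; lra.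
  by rewrite in_itv/=; exists s.
exists (fun x => w x + h x); split.
- apply: continuous_in_subspaceT => x; rewrite inE/= => xr.
  apply: cvgD; first exact: potential_continuous.
  by apply: ch; move: xr; rewrite in_itv.
- by apply: aeS aeS' => x k /k Sx; rewrite hS// addrC subrK.
- move=> x; rewrite in_itv/= => /andP[x1 x2].
  by apply: ltr_wpDr; [exact: h0|exact: w0].
Qed.

Lemma supersolution_slopes (u v dv : R -> R) :
  (forall x y : R, 0 <= x -> x <= y -> y < rad -> w y <= w x) ->
  (forall x : R, x \in `]- rad, rad[ -> u (- x) = u x) ->
  vw_supersolution rad f u -> C1_rep rad u v dv -> dv rad <= 0 /\ 0 <= dv (- rad).
Proof.
move=> wmono uev su C; have [S [Sr Sg cS aeS']] := supersolution_structure su.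
have aeSN : {ae mu, forall x : R, x \in `]- rad, rad[ -> S (- x)}.
  by apply: aeS (ae_oppr aeS') => x k xr; apply: k; move: xr; rewrite !in_itv/=; lra.
have wev (x : R) : - rad < x < rad -> w (- x) = w x.
  by move=> xr; apply: (potential_even rad0 mf ev fint); lra.
(* The mirror point is included because [concave_even_nonincreasing] needs both [y] and [- y] in
   [S]. *)
pose Q x := [/\ S x, S (- x) & v x = u x].
have aeQ : {ae mu, forall x : R, x \in `]- rad, rad[ -> Q x}.
  case: C => vu _ _ _; apply: aeS (aeI (aeI aeS' aeSN) vu) => x [[k1 k2] k3] xr.
  by split; [exact: k1|exact: k2|exact: k3].
have umono (x y : R) : 0 < x -> x < y -> y < rad -> S x -> S y -> S (- y) -> u y <= u x.
  move=> x0 xy yr Sx Sy Sny.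
  have yr' : - rad < y < rad by have rp := rad0; lra.
  have := concave_even_nonincreasing cS x0 xy Sny Sx Sy.
  rewrite uev ?in_itv//= wev// => /(_ erefl).
  have : w y <= w x by apply: wmono => //; exact: ltW.
  lra.
split.
- apply: (C1_rep_right_le0 rad0 C aeQ) => x y x0 xy yr [Sx _ ->] [Sy Sny ->].
  exact: umono.
- apply: (C1_rep_left_ge0 rad0 C aeQ) => x y xr xy y0 [Sx Snx ->] [Sy Sny ->].
  rewrite -(uev x); last by have rp := rad0; rewrite in_itv/=; lra.
  rewrite -(uev y); last by have rp := rad0; rewrite in_itv/=; lra.
  by apply: umono; rewrite ?opprK//; lra.
Qed.

(** Integrability of [f] up to the endpoints makes [primitive f] continuous on the closed interval;
    this is where the finite mass of [f^-] enters. *)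
Lemma potential_C1 (u : R -> R) : mu.-integrable `]- rad, rad[ (EFin \o f) ->
  {ae mu, forall x : R, x \in `]- rad, rad[ -> u x = w x} ->
  C1_rep rad u w (fun x => - primitive f x).
Proof.
move=> fi uw; split.
- by apply: aeS uw => x h /h ->.
- exact: potential_continuous_closed.
- by move=> x; apply: cvgN; exact: primitive_continuous_closed.
- by move=> x xr; exact: potential_is_derive.
Qed.

(** The boundary slopes do not depend on the representative, so they may be computed on [w], where
    they are [- primitive f] at the endpoints. *)
Lemma C1_rep_unique (u v1 dv1 v2 dv2 : R -> R) :
  C1_rep rad u v1 dv1 -> C1_rep rad u v2 dv2 ->
  dv1 rad = dv2 rad /\ dv1 (- rad) = dv2 (- rad).
Proof.
move=> [e1 c1 d1 D1] [e2 c2 d2 D2].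
have lt : - rad < rad by have rp := rad0; lra.
have [k1 _ _] := (continuous_within_itvP _ lt).1 c1.
have [k2 _ _] := (continuous_within_itvP _ lt).1 c2.
have e : forall x : R, x \in `]- rad, rad[ -> v1 x = v2 x.
  apply: continuous_ae_eq => //.
  by apply: aeS (aeI e1 e2) => x [h1 h2] xr; rewrite h1// h2.
have de : forall x : R, x \in `]- rad, rad[ -> dv1 x = dv2 x.
  move=> x xr; have h1 := D1 _ xr; have h2 := D2 _ xr.
  rewrite -(@derive_val _ _ _ _ _ _ _ h1) -(@derive_val _ _ _ _ _ _ _ h2).
  apply: near_eq_derive; near=> y; apply: e.
  by near: y; exact: near_in_itvoo.
by have [] := continuous_closed_eq lt d1 d2 de.
Unshelve. all: by end_near. Qed.

(** Up to [r0] the weight is bounded below; beyond it [|f| = f^-] a.e.; the negative half follows by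
    evenness. *)
Lemma integrable_of_fneg (r0 : R) : 0 < r0 -> r0 < rad ->
  {ae mu, forall r : R, r \in `]r0, rad[ -> f r <= 0} ->
  (\int[mu]_(s in `]r0, rad[) (fneg f s)%:E < +oo)%E ->
  mu.-integrable `]- rad, rad[ (EFin \o f).
Proof.
move=> r00 r0rad fn fin; have rp := rad0.
have mf0 : measurable_fun `]0, rad[ f by apply: measurable_sub_oo mf; lra.
have m1 : measurable_fun `]r0, rad[ f by apply: measurable_sub_oo mf; lra.
have i1 : mu.-integrable `]0, rad[ (EFin \o f).
  apply: (@integrable_join _ _ r0 _ f (ltW r00) (ltW r0rad)).
    exact: integrable_weight r0rad mf0 fint.
  apply/integrableP; split; first exact/measurable_EFinP.
  apply: le_lt_trans fin; apply: ae_ge0_le_integral => //.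
  - by apply/measurable_EFinP; exact: measurableT_comp.
  - by move=> x _; rewrite lee_fin fneg_ge0.
  - by apply/measurable_EFinP; exact: measurable_fneg.
  - by apply: aeS fn => x /= h xr; rewrite lee_fin fnegE ?h// ler0_norm ?h.
apply: (@integrable_join _ _ 0 _ f) => //; [lra|lra|].
have := integrable_oppr_oo i1; rewrite oppr0; apply: eq_integrable => // x.
rewrite inE/= in_itv/= => /andP[x1 x2]; rewrite ev// in_itv/=; lra.
Qed.

End supersolutions.

Unset Implicit Arguments.

Theorem theorem1 (R : realType) (rad r0 : R) (f : R -> R)
  (hrad : 0 < rad)
  (hfmeas : measurable_fun (`]-rad, rad[%classic)%R f)
  (hfeven : forall x, x \in `]-rad, rad[ -> f (- x) = f x)
  (hfint : (\int[@lebesgue_measure R]_(s in (`]0, rad[%classic)%R)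
              (`|f s| * (rad - s))%R%:E < +oo)%E)
  (hr0 : r0 \in `]0, rad[)
  (hfpos : {ae @lebesgue_measure R, forall r, r \in `]0, r0[ -> 0 <= f r})
  (hfpos_nz : ~ {ae @lebesgue_measure R,
                  forall r, r \in `]0, r0[ -> fpos f r = 0})
  (hfneg : {ae @lebesgue_measure R, forall r, r \in `]r0, rad[ -> f r <= 0}) :
  (* (A) *)
  (balance rad r0 f -> decay rad r0 f ->
     forall u : R -> R,
       (forall x, x \in `]-rad, rad[ -> u (- x) = u x) ->
       vw_supersolution rad f u ->
       pos_in rad u /\
       (forall v dv, C1_rep rad u v dv -> dv rad <= 0 /\ 0 <= dv (- rad))) /\
  (balance rad r0 f ->
     forall u : R -> R, vw_solution rad f u ->
       (pos_in rad u <-> decay rad r0 f)) /\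
  (* (B) *)
  (balance rad r0 f -> decay rad r0 f ->
   (\int[@lebesgue_measure R]_(s in (`]r0, rad[%classic)%R) (fneg f s)%:E < +oo)%E ->
     forall u : R -> R, vw_solution rad f u ->
       (exists v dv, C1_rep rad u v dv) /\
       (forall v dv, C1_rep rad u v dv ->
          ((dv rad = 0 /\ dv (- rad) = 0) <->
             (\int[@lebesgue_measure R]_(s in (`]0, r0[%classic)%R) (fpos f s)%:E
              = \int[@lebesgue_measure R]_(s in (`]r0, rad[%classic)%R) (fneg f s)%:E)%E) /\
          ((dv rad = 0 /\ dv (- rad) = 0) <->
             (\int[@lebesgue_measure R]_(s in (`]0, rad[%classic)%R) (f s)%:E = 0)%E))).
Proof.
have [r00 r0rad] : 0 < r0 /\ r0 < rad by move: hr0; rewrite in_itv/= => /andP[].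
have ltr : - rad < rad by move: hrad; clear; lra.
pose w := potential rad f.
have cw : {in `]- rad, rad[, continuous w} by exact: potential_continuous.
have wE := decayP hrad hfmeas hfeven hfint r00 r0rad hfpos hfneg.
have w0 := potential_gt0 hrad hfmeas hfeven hfint r00 r0rad hfpos hfneg.
split; [|split].
- move=> _ dec u uev su; split.
    by apply: supersolution_pos_in su => // x x1 x2; exact: w0.
  move=> v dv C; apply: (supersolution_slopes hrad hfmeas hfeven hfint _ uev su C).
  exact: (potential_nonincreasing hrad hfmeas hfeven hfint r00 r0rad hfpos hfneg dec).
- move=> _ u su; have uw := solution_ae hrad hfmeas hfeven hfint su; split.
    (* [pos_in] yields some continuous [v] equal to [w] a.e.; continuity makes them equal
       everywhere, so the sign passes to [w] and [decayP] gives the decay condition. *)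
    move=> [v [cv vu v0]]; apply/wE => x xr.
    have cv' : {in `]- rad, rad[, continuous v}.
      apply/in_continuous_mksetP; rewrite -continuous_open_subspace; last exact: interval_open.
      exact: cv.
    have xr' : x \in `]- rad, rad[.
      by move: xr hrad r00; rewrite !in_itv/=; clear; lra.
    have vw : {ae @lebesgue_measure R, forall x : R, x \in `]- rad, rad[ -> v x = w x}.
      by apply: aeS (aeI vu uw) => y [h1 h2] yr; rewrite h1// h2.
    by rewrite -[potential rad f x](continuous_ae_eq cv' cw vw xr') v0.
  move=> dec; exists w; split.
  + by apply: continuous_in_subspaceT => x; rewrite inE/= => xr; exact: cw.
  + by apply: aeS uw => x h /h ->.
  + by move=> x; rewrite in_itv/= => /andP[x1 x2]; exact: w0.
- move=> _ dec fin u su; have uw := solution_ae hrad hfmeas hfeven hfint su.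
  have fi := integrable_of_fneg hrad hfmeas hfeven hfint r00 r0rad hfneg fin.
  have C0 := potential_C1 hrad hfmeas hfeven hfint fi uw.
  split; first by exists w, (fun x => - primitive f x).
  move=> v dv C; have [-> ->] := C1_rep_unique hrad C C0.
  have fi0 : lebesgue_measure.-integrable `]0, rad[ (EFin \o f).
    by apply: integrable_sub_oo fi => //; rewrite oppr_le0 ltW.
  have F_odd : primitive f (- rad) = - primitive f rad.
    by apply: (primitive_odd hfmeas hfeven); rewrite lexx ltW.
  (* By oddness of the primitive the two endpoint conditions reduce to [primitive f rad = 0], which
     is then read as [P = N rad] or as the vanishing of the integral of [f]. *)
  have flat : - primitive f rad = 0 /\ - primitive f (- rad) = 0 <-> primitive f rad = 0.
    rewrite F_odd opprK; split=> [[]//|->]; by rewrite oppr0.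
  rewrite (integral_fpos hrad hfmeas hfint r0rad).
  rewrite (integral_fneg hrad hfmeas r00 (ltW r0rad) fi0 (lexx rad)).
  split; apply: (iff_trans flat).
    have := primitive_fpos_fneg hrad hfmeas r00 r0rad hfpos hfneg (ltW r0rad) (lexx rad) fi0.
    move=> ->; split=> [/eqP|[->]]; last by rewrite subrr.
    by rewrite subr_eq0 => /eqP ->.
  have -> : (\int[lebesgue_measure]_(s in `]0%R, rad[) (f s)%:E = (primitive f rad)%:E)%E.
    by rewrite primitive_pos ?ltW// fineK//; apply: integrable_fin_num.
  by split=> [->|[]].
Qed.
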